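(* $\mathcal{M}(\Delta^3)\simeq\bigvee^{99}S^4$.
   Context: All simplicial complexes are finite abstract simplicial complexes; simplices are nonempty. $\Delta^3$ is the simplicial complex of all nonempty subsets of a $4$-element vertex set. The Hasse diagram $\mathcal{H}(K)$ of $K$ is the directed graph whose vertices are the simplices of $K$, with an edge $\sigma\to\tau$ whenever $\sigma\subsetneq\tau$ and $\dim\tau=\dim\sigma+1$. A matching on $\mathcal{H}(K)$ is a set $W$ of edges of $\mathcal{H}(K)$, no two sharing a vertex. $W$ is acyclic if the directed graph obtained from $\mathcal{H}(K)$ by reversing every edge in $W$ has no directed cycle. The complex of discrete Morse matchings $\mathcal{M}(K)$ is the simplicial complex whose vertices are the edges of $\mathcal{H}(K)$ and whose simplices are the nonempty acyclic matchings on $\mathcal{H}(K)$. *)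

(* Defs.v *)
From HB Require Import structures.
From mathcomp Require Import all_boot all_order all_algebra.
From mathcomp Require Import all_classical all_reals all_analysis.
From mathcomp Require Import wedge_sigT.

Set Implicit Arguments.
Unset Strict Implicit.
Unset Printing Implicit Defensive.
Import Order.TTheory GRing.Theory Num.Theory.
Import numFieldNormedType.Exports.

Definition is_simplicial_complex (V : finType) (K : {set {set V}}) : Prop :=
  finset.set0 \notin K /\
  (forall s t : {set V}, s \in K -> t \subset s -> t != finset.set0 -> t \in K).

(* The full simplex on V: all nonempty subsets of V.  Delta^3 = full_simplex 'I_4. *)
Definition full_simplex (V : finType) : {set {set V}} :=
  [set s : {set V} | s != finset.set0].

Definition hasse_edge (V : finType) (K : {set {set V}})
  (e : {set V} * {set V}) : bool :=
  [&& e.1 \in K, e.2 \in K, e.1 \proper e.2 & #|e.2| == #|e.1|.+1].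

Definition is_matching (V : finType) (K : {set {set V}})
  (W : {set {set V} * {set V}}) : bool :=
  [forall e in W, hasse_edge K e] &&
  [forall e in W, forall f in W, (e != f) ==>
     [&& e.1 != f.1, e.1 != f.2, e.2 != f.1 & e.2 != f.2]].

Definition modified_arc (V : finType) (K : {set {set V}})
  (W : {set {set V} * {set V}}) : rel {set V} :=
  fun x y => (hasse_edge K (x, y) && ((x, y) \notin W)) || ((y, x) \in W).

Definition has_directed_cycle (T : eqType) (r : rel T) : Prop :=
  exists (x : T) (p : seq T), [&& p != [::], path r x p & last x p == x].

Definition is_acyclic (V : finType) (K : {set {set V}})
  (W : {set {set V} * {set V}}) : Prop :=
  ~ has_directed_cycle (modified_arc K W).

(* The complex of discrete Morse matchings M(K): vertex set = edges of H(K)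
   (encoded inside the finite type {set V} * {set V}); simplices = nonempty
   acyclic matchings. *)
Definition morse_complex (V : finType) (K : {set {set V}})
  : {set {set ({set V} * {set V})}} :=
  [set W : {set ({set V} * {set V})} |
     [&& W != finset.set0, is_matching K W & `[< is_acyclic K W >] ]].

Local Open Scope classical_set_scope.
Local Open Scope ring_scope.

Definition geom_real (R : realType) (V : finType) (K : {set {set V}})
  : set (prod_topology (fun _ : V => R)) :=
  [set x | (forall v, 0 <= x v) /\ \sum_(v : V) x v = 1 /\
           ([set v : V | x v != 0])%SET \in K].

Definition sphere (R : realType) (n : nat) : set (prod_topology (fun _ : 'I_n.+1 => R)) :=
  [set x | \sum_(i : 'I_n.+1) x i ^+ 2 = 1].

Definition sphere_base (R : realType) (n : nat) : prod_topology (fun _ : 'I_n.+1 => R) :=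
  fun i => if i == ord0 then 1 else 0.

Lemma sphere_base_in (R : realType) (n : nat) : @sphere_base R n \in @sphere R n.
Proof.
apply/mem_set; rewrite /sphere /= big_ord_recl /sphere_base eqxx expr1n.
rewrite big1 ?addr0 // => i _.
by rewrite eq_sym (negbTE (neq_lift ord0 i)) expr0n.
Qed.

Definition sphere_space (R : realType) (n : nat) : topologicalType :=
  set_type (@sphere R n).

Definition sphere_pt (R : realType) (n : nat) : sphere_space R n :=
  exist _ (@sphere_base R n) (@sphere_base_in R n).

Definition wedge_spheres (R : realType) (k n : nat) : topologicalType :=
  @wedge 'I_k (fun _ => sphere_space R n) (fun _ => sphere_pt R n).

Definition unit_interval (R : realType) : set R := [set t : R | 0 <= t <= 1].

Definition homotopic (R : realType) (X Y : topologicalType) (f g : X -> Y) : Prop :=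
  exists H : (set_type (@unit_interval R) * X)%type -> Y,
    continuous H /\
    (forall t x, set_val t = 0 -> H (t, x) = f x) /\
    (forall t x, set_val t = 1 -> H (t, x) = g x).

Definition homotopy_equivalent (R : realType) (X Y : topologicalType) : Prop :=
  exists (f : X -> Y) (g : Y -> X),
    [/\ continuous f, continuous g,
        homotopic R (g \o f) idfun & homotopic R (f \o g) idfun].

Definition realization (R : realType) (V : finType) (K : {set {set V}})
  : topologicalType := set_type (@geom_real R V K).

(* Main.v *)
Require Import Defs.
From HB Require Import structures.
From mathcomp Require Import all_boot all_order all_algebra.
From mathcomp Require Import all_classical all_reals all_analysis.
From mathcomp Require Import wedge_sigT.
From mathcomp Require Import ring lra.

(** The acyclic matchings are the sets of edges of the Hasse diagram containing
neither two incident edges nor an alternating cycle of length 3 or 4, so the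
12820 faces of M(Delta^3) can be enumerated.  A greedy sequence of elementary
collapses leads from M(Delta^3) to a 4-dimensional subcomplex L, and a second
one from L without 99 of its facets to a single vertex; both are verified by
computation.  An elementary collapse is realized by moving the points of the
free face sigma along x + t m(x) (|sigma| e_v - 1_sigma), with m the least
barycentric coordinate on sigma: this formula makes sense on the whole ambient
space, so that the deformations compose without any gluing.  The contraction
of the subcomplex A = L minus the facets extends to a homotopy of L by the
homotopy extension property, again through an explicit ambient formula, hence
L is equivalent to L/A, which is identified with the wedge of spheres by
inverse stereographic projections. *)

Set Implicit Arguments.
Unset Strict Implicit.
Unset Printing Implicit Defensive.
Import Order.TTheory GRing.Theory Num.Theory.
Import numFieldNormedType.Exports.

(** * Continuity *)

Local Open Scope classical_set_scope.
Local Open Scope ring_scope.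

Section Continuity.
Context {X Y Z : topologicalType}.

(** Lengths 3 and 4 arise as follows. A simple cycle in the modified diagram alternates between two
    adjacent dimensions, with one matched edge for each lower simplex it visits. Two simplices of
    equal dimension have at most one common coface, so at least 3 matched edges occur; and one of
    the two levels has at most 4 simplices, so at most 4 occur. That these obstructions suffice is
    confirmed by computation: every face of the complex they define is checked to be acyclic. The
    complex L is not contractible, so no collapse takes it to a point; taking out one open top
    simplex per sphere removes the obstruction. Those 99 facets are the only data supplied: the free
    faces are found again by the verified computation, and no collapsing sequence is recorded. *)

Lemma continuous_pair (f : X -> Y) (g : X -> Z) : continuous f -> continuous g ->
  continuous (fun x => (f x, g x)).
Proof. by move=> cf cg x; apply: (cvg_pair (cf x) (cg x)). Qed.

Lemma continuous_compose (f : X -> Y) (g : Y -> Z) : continuous f -> continuous g ->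
  continuous (fun x => g (f x)).
Proof. by move=> cf cg x; apply: continuous_comp; [exact: cf|exact: cg]. Qed.

Lemma continuous_fst : continuous (fun p : X * Y => p.1).
Proof. by move=> p; exact: cvg_fst. Qed.

Lemma continuous_snd : continuous (fun p : X * Y => p.2).
Proof. by move=> p; exact: cvg_snd. Qed.

End Continuity.

Section RealContinuity.
Context {R : realType} {X : topologicalType}.
Implicit Types f g : X -> R.

Lemma continuous_addr f g : continuous f -> continuous g ->
  continuous (fun x => f x + g x).
Proof. by move=> cf cg x; apply: cvgD; [exact: cf|exact: cg]. Qed.

Lemma continuous_oppr f : continuous f -> continuous (fun x => - f x).
Proof. by move=> cf x; apply: cvgN; exact: cf. Qed.

Lemma continuous_subr f g : continuous f -> continuous g ->
  continuous (fun x => f x - g x).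
Proof. by move=> cf cg; apply: continuous_addr => //; exact: continuous_oppr. Qed.

Lemma continuous_mulr f g : continuous f -> continuous g ->
  continuous (fun x => f x * g x).
Proof. by move=> cf cg x; apply: cvgM; [exact: cf|exact: cg]. Qed.

Lemma continuous_divr f g : continuous f -> continuous g ->
  (forall x, g x != 0) -> continuous (fun x => f x / g x).
Proof.
move=> cf cg g0; apply: continuous_mulr => // x.
by apply: cvgV => //; exact: cg.
Qed.

Lemma continuous_minr f g : continuous f -> continuous g ->
  continuous (fun x => Order.min (f x) (g x)).
Proof. by move=> cf cg x; apply: (@continuous_min R X f g); [exact: cf|exact: cg]. Qed.

Lemma continuous_maxr f g : continuous f -> continuous g ->
  continuous (fun x => Order.max (f x) (g x)).
Proof. by move=> cf cg x; apply: (@continuous_max R X f g); [exact: cf|exact: cg]. Qed.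

Lemma continuous_sumr (I : Type) (r : seq I) (P : pred I) (F : I -> X -> R) :
  (forall i, continuous (F i)) -> continuous (fun x => \sum_(i <- r | P i) F i x).
Proof.
move=> cF; apply: (@continuous_big R) => //.
by move=> x; apply: cvgD; [exact: cvg_fst|exact: cvg_snd].
Qed.

Lemma continuous_bigminr (I : Type) (r : seq I) (P : pred I) (a : R)
  (F : I -> X -> R) : (forall i, continuous (F i)) ->
  continuous (fun x => \big[Order.min/a]_(i <- r | P i) F i x).
Proof.
move=> cF; apply: (@continuous_big R) => //.
exact: min_continuous.
Qed.

Lemma continuous_cstr (a : R) : continuous (fun _ : X => a).
Proof. by move=> x; exact: cvg_cst. Qed.

End RealContinuity.

Notation ptws V R := (prod_topology (fun _ : V => R)).

Section Pointwise.
Context {R : realType} {V : finType}.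

Lemma continuous_ptws (X : topologicalType) (f : X -> ptws V R) :
  (forall v, continuous (fun x => f x v)) -> continuous f.
Proof.
move=> cf x; apply/cvg_sup => v; apply/cvg_image.
  rewrite eqEsubset; split => // y _; exists (fun=> y) => //.
move=> U /cf; rewrite /nbhs /= => fU.
exists ((fun g : V -> R => g v) @^-1` U) => //.
rewrite eqEsubset; split => [y [g Ug <-]//|y Uy].
by exists (fun=> y).
Qed.

Lemma continuous_coord (v : V) : continuous (fun x : ptws V R => x v).
Proof. exact: (@proj_continuous V (fun=> R) v). Qed.

Lemma hausdorff_ptws : hausdorff_space (ptws V R).
Proof. by apply: hausdorff_product => _; exact: norm_hausdorff. Qed.

End Pointwise.

Section SetType.
Context {T : topologicalType} (A : set T).

Lemma continuous_set_val : continuous (set_val : A -> T).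
Proof. exact: initial_continuous. Qed.

Lemma continuous_into_set (X : topologicalType) (f : X -> A) :
  continuous (set_val \o f) -> continuous f.
Proof.
move=> cf; apply/continuousP => U [B oB <-].
by move/continuousP: cf => /(_ _ oB).
Qed.

Lemma compact_set_type : compact A -> compact [set: A].
Proof.
move=> cA F FF _; have FA : (set_val @ F) A.
  rewrite /fmap /=; apply: (filterS _ (@filterT _ F _)) => x _ /=.
  by case: x => x Ax; exact: set_mem Ax.
have [x [Ax clx]] := cA (set_val @ F) _ FA.
exists (exist _ x (mem_set Ax)); split => // B N FB [_ [[W oW <-] /= Wx WN]].
have [| |y [[b Bb <-] Wb]] := clx (set_val @` B) W.
- by rewrite /fmap /=; apply: filterS FB; exact: preimage_image.
- by apply: open_nbhs_nbhs.
by exists b; split => //; exact: WN.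
Qed.

Lemma hausdorff_set_type : hausdorff_space T -> hausdorff_space A.
Proof.
move=> hT x y clxy; apply/val_inj/hT => U W /continuous_set_val nU.
by move=> /continuous_set_val nW; have [z [? ?]] := clxy _ _ nU nW; exists (val z).
Qed.

End SetType.

(** * Ambient deformations and elementary collapses *)

Section Deformations.
Context {R : realType} {V : finType}.
Implicit Types (K L M : set (ptws V R)) (D : R * ptws V R -> ptws V R).

Definition deformation D K L :=
  [/\ continuous D, forall x, D (0, x) = x,
      forall (t : R) x, 0 <= t <= 1 -> K x -> K (D (t, x)) &
      forall x, K x -> L (D (1, x))].

(** Both times are clamped, so on either half of the unit interval one of the two deformations
    stands still; the formula is continuous with no case distinction on time. *)
Definition concat D1 D2 : R * ptws V R -> ptws V R :=
  fun p => D2 (Order.max 0 (2 * p.1 - 1), D1 (Order.min 1 (2 * p.1), p.2)).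

Lemma concat0 D1 D2 x : (forall x, D1 (0, x) = x) -> (forall x, D2 (0, x) = x) ->
  concat D1 D2 (0, x) = x.
Proof.
move=> D10 D20; rewrite /concat /= mulr0 sub0r.
by rewrite max_l ?min_r ?ler01 ?D10 ?D20 ?oppr_le0.
Qed.

Lemma concat1 D1 D2 x : concat D1 D2 (1, x) = D2 (1, D1 (1, x)).
Proof. by rewrite /concat /= max_r ?min_l; [congr D2; congr pair|..]; lra. Qed.

Lemma continuous_concat D1 D2 : continuous D1 -> continuous D2 ->
  continuous (concat D1 D2).
Proof.
move=> c1 c2; have cfst : continuous (fun p : R * ptws V R => 2 * p.1).
  by apply: continuous_mulr; [exact: continuous_cstr|exact: continuous_fst].
apply: continuous_compose c2; apply: continuous_pair.
  apply: continuous_maxr; first exact: continuous_cstr.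
  by apply: continuous_subr => //; exact: continuous_cstr.
apply: continuous_compose c1; apply: continuous_pair; last exact: continuous_snd.
by apply: continuous_minr => //; exact: continuous_cstr.
Qed.

Lemma deformation_concat D1 D2 K L M : L `<=` K ->
  deformation D1 K L -> deformation D2 L M -> deformation (concat D1 D2) K M.
Proof.
move=> LK [c1 D10 D1K D1L] [c2 D20 D2L D2M]; split.
- exact: continuous_concat.
- by move=> x; exact: concat0.
(* While the first deformation is under way the second is at time 0, hence the identity; nothing is
   asked of [D2] outside [L]. *)
- move=> t x t01 Kx; rewrite /concat /=; have [t2|t2] := leP (2 * t) 1.
    by rewrite max_l ?D20; [apply: D1K|]; rewrite ?min_r //; lra.
  apply: LK; apply: D2L; first by rewrite max_r; lra.
  exact: D1L.
- by move=> x Kx; rewrite concat1; apply: D2M; exact: D1L.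
Qed.

Definition deforms K L := L `<=` K /\ exists2 D, deformation D K L &
  forall (t : R) x, 0 <= t <= 1 -> L x -> D (t, x) = x.

Lemma deforms_refl K : deforms K K.
Proof. by split => //; exists snd => //; split => //; exact: continuous_snd. Qed.

Lemma deforms_trans K L M : deforms K L -> deforms L M -> deforms K M.
Proof.
move=> [LK [D1 d1 f1]] [ML [D2 d2 f2]]; split; first exact: subset_trans LK.
exists (concat D1 D2); first exact: deformation_concat d2.
move=> t x t01 Mx; rewrite /concat /=.
have t1 : 0 <= Order.min 1 (2 * t) <= 1.
  by rewrite le_min ge_min lexx ler01; lra.
have t2 : 0 <= Order.max 0 (2 * t - 1) <= 1.
  by rewrite le_max ge_max lexx ler01; lra.
by rewrite f1 ?f2 //; exact: ML.
Qed.

End Deformations.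

(** * Barycentric coordinates and elementary collapses of free faces *)

Section Geometry.
Context {R : realType} {V : finType}.
Implicit Types (K L : {set {set V}}) (s : {set V}) (x : ptws V R).

Local Notation geom := (@geom_real R V).

Definition supp x : {set V} := [set v | x v != 0]%SET.

Lemma geom_realE K x :
  geom K x <-> [/\ forall v, 0 <= x v, \sum_v x v = 1 & supp x \in K].
Proof. by split=> [[? [? ?]]|[? ? ?]]. Qed.

Lemma supp_neq0 x : \sum_v x v = 1 -> supp x != finset.set0.
Proof.
apply: contra_eq_neq => /setP s0; rewrite big1 ?(eq_sym 0) ?oner_neq0 // => v _.
by apply/eqP; have := s0 v; rewrite !inE => /negbFE.
Qed.

Lemma coord_le1 x v : (forall v, 0 <= x v) -> \sum_v x v = 1 -> x v <= 1.
Proof. by move=> x0 <-; rewrite (bigD1 v) //= lerDl sumr_ge0. Qed.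

(** A continuous test for containing [s]: on the simplex, [vmin s x] is nonzero exactly when [s]
    lies in the support of [x]. The default 1 is harmless for nonempty [s], as barycentric
    coordinates are at most 1. *)
Definition vmin s x : R := \big[Order.min/1]_(u in s) x u.

Lemma vmin_ge0 s x : (forall v, 0 <= x v) -> 0 <= vmin s x.
Proof. by move=> x0; apply: le_bigmin. Qed.

Lemma vmin_le s x u : u \in s -> vmin s x <= x u.
Proof. by move=> us; exact: bigmin_le_cond. Qed.

Lemma vmin_eq s x : s != finset.set0 -> (forall v, 0 <= x v) ->
  \sum_v x v = 1 -> exists2 u, u \in s & vmin s x = x u.
Proof.
move=> /set0Pn[u us] x0 x1.
have [|w ws e] := @eq_bigmin _ _ _ 1 u (fun u => u \in s) (fun u => x u) us.
  by move=> w _; exact: coord_le1.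
by exists w.
Qed.

Lemma vmin_supp s x : (forall v, 0 <= x v) -> vmin s x != 0 -> s \subset supp x.
Proof.
move=> x0 m0; apply/fintype.subsetP => u us; rewrite inE; apply: contraNneq m0 => xu.
by rewrite eq_le vmin_ge0 // andbT -xu; exact: vmin_le.
Qed.

Lemma supp_vmin s x : s != finset.set0 -> (forall v, 0 <= x v) ->
  \sum_v x v = 1 -> s \subset supp x -> vmin s x != 0.
Proof.
move=> s0 x0 x1 /fintype.subsetP ss; have [u us ->] := vmin_eq s0 x0 x1.
by have := ss u us; rewrite inE.
Qed.

Lemma continuous_vmin (X : topologicalType) s (f : X -> ptws V R) :
  (forall v, continuous (f^~ v)) -> continuous (fun y => vmin s (f y)).
Proof. by move=> cf; exact: continuous_bigminr. Qed.

Definition push s v : R * ptws V R -> ptws V R := fun p w =>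
  p.2 w + p.1 * vmin s p.2 * (if w == v then #|s|%:R else - (w \in s)%:R).

Lemma continuous_push s v : continuous (push s v).
Proof.
have c2 w : continuous (fun p : R * ptws V R => p.2 w).
  apply: (@continuous_compose _ _ _ snd (fun x : ptws V R => x w)).
    exact: continuous_snd.
  exact: continuous_coord.
apply: continuous_ptws => w; apply: continuous_addr; first exact: c2.
apply: continuous_mulr; last exact: continuous_cstr.
by apply: continuous_mulr; [exact: continuous_fst|exact: continuous_vmin].
Qed.

Lemma sum_push s v t x : v \notin s -> \sum_w push s v (t, x) w = \sum_w x w.
Proof.
move=> vs; rewrite big_split /= -mulr_sumr.
suff -> : \sum_w (if w == v then #|s|%:R else - (w \in s)%:R) = 0 :> R.
  by rewrite mulr0 addr0.
rewrite (bigD1 v) //= eqxx (eq_bigr (fun w => - (w \in s)%:R)) => [|w /negbTE -> //].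
rewrite sumrN -sum1_card natr_sum big_mkcond (bigD1 v) //= (negbTE vs) add0r.
rewrite [X in X - _](eq_bigr (fun w => (w \in s)%:R)) ?subrr //.
by move=> w _; case: (w \in s).
Qed.

Definition free_face K s v := [/\ s \in K, v \notin s, v |: s \in K &
  forall r, r \in K -> s \subset r -> r = s \/ r = v |: s].

(** Freeness means that [vmin s] is nonzero only on the open faces [s] and [v |: s], so [push] fixes
    everything else. At time 1 a vertex of [s] with least coordinate reaches 0, and the support is
    then a face of [v |: s] that no longer contains [s]. *)
Lemma deforms_free_face K s v : is_simplicial_complex K -> free_face K s v ->
  deforms (geom K) (geom (K :\: [set s; (v |: s)%SET])%SET).
Proof.
move=> [K0 Kd] [sK vs vsK fr].
have s0 : s != finset.set0 by apply: contraNneq K0 => <-.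
set L := (K :\: _)%SET.
have mL x : geom L x -> vmin s x = 0.
  move=> /geom_realE[x0 x1]; rewrite !inE negb_or => /andP[/andP[/eqP ns /eqP nvs] xK].
  by apply/eqP/negPn/negP => /(vmin_supp x0) /(fr _ xK) [].
have push0 t x : vmin s x = 0 -> push s v (t, x) = x.
  by move=> m0; apply/funext => w; rewrite /push /= m0 mulr0 mul0r addr0.
have pushK t x : 0 <= t <= 1 -> geom K x -> vmin s x != 0 ->
  [/\ forall w, 0 <= push s v (t, x) w, \sum_w push s v (t, x) w = 1,
      supp (push s v (t, x)) \in K & supp (push s v (t,x)) \subset v |: s].
  move=> /andP[t0 t1] /geom_realE[x0 x1 xK] m0.
  have p1 : \sum_w push s v (t, x) w = 1 by rewrite sum_push.
  have sv : supp (push s v (t, x)) \subset v |: s.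
    have xvs : supp x \subset v |: s.
      by have [->|->] := fr _ xK (vmin_supp x0 m0); rewrite ?subsetU1.
    apply/fintype.subsetP => w; apply: contraLR => wvs.
    have := contra (fintype.subsetP xvs w) wvs; move: wvs.
    rewrite !inE !negb_or => /andP[/negbTE wv /negbTE ws] /negPn/eqP xw.
    by rewrite negbK /push /= xw wv ws /= oppr0 mulr0 addr0.
  split => //; last exact: Kd vsK sv (supp_neq0 p1).
  move=> w; rewrite /push /=; have m0' := vmin_ge0 s x0.
  case: ifP => _; first by rewrite addr_ge0 // !mulr_ge0.
  case: (boolP (w \in s)) => ws; last by rewrite oppr0 mulr0 addr0.
  by rewrite mulrN mulr1 subr_ge0; apply: le_trans (vmin_le x ws); rewrite ler_piMl.
split.
  by move=> x /geom_realE[x0 x1 xL]; split => //; split => //; case/setDP: xL.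
exists (push s v); last by move=> t x _ /mL; exact: push0.
split; first exact: continuous_push.
- by move=> x; apply/funext => w; rewrite /push /= !mul0r addr0.
- move=> t x t01 Kx; have [m0|m0] := eqVneq (vmin s x) 0; first by rewrite push0.
  by have [? ? ? _] := pushK t x t01 Kx m0; apply/geom_realE.
- move=> x Kx; have [x0 x1 xK] := (geom_realE K x).1 Kx.
  have [m0|m0] := eqVneq (vmin s x) 0.
    rewrite push0 //; apply/geom_realE; split => //; apply/setDP; split => //.
    rewrite !inE; apply/negP => /orP ss; move/eqP: m0; apply/negP.
    by apply: supp_vmin => //; case: ss => /eqP ->; rewrite ?subsetU1.
  have [|p0 p1 pK _] := pushK 1 x _ Kx m0; first by rewrite ler01 lexx.
  apply/geom_realE; split => //; apply/setDP; split => //.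
  have [u us mu] := vmin_eq s0 x0 x1.
  have pu : u \notin supp (push s v (1, x)).
    rewrite inE negbK /push /= mu mul1r us ifN ?mulrN ?mulr1 ?subrr //.
    by apply: contraNneq vs => <-.
  by rewrite !inE; apply/negP => /orP[] /eqP e; move: pu; rewrite e ?inE us ?orbT.
Qed.

End Geometry.

(** * Attaching facets to a contractible subcomplex *)

Section Contraction.
Context {R : realType} {V : finType}.
Implicit Types (K L A : {set {set V}}) (F s : {set V}) (v : V) (a x : ptws V R).
Implicit Types (D : R * ptws V R -> ptws V R).
Local Notation geom := (@geom_real R V).

(** A homotopy of the pair [(L, A)] whose end squeezes [A] to [a]. Keeping [A] invariant at all
    times is what lets it descend to [L/A]; the point [a] may move on the way. *)
Definition contracts D L A a :=
  [/\ continuous D, forall x, D (0, x) = x,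
      forall (t : R) x, 0 <= t <= 1 -> geom L x -> geom L (D (t, x)),
      forall (t : R) x, 0 <= t <= 1 -> geom A x -> geom A (D (t, x)) &
      forall x, geom A x -> D (1, x) = a].

(** With [b] the barycentre of [F], this is the point [y] such that
    [x = (1 - #|F| * k) y + #|F| * k b]. It moves radially away from [b] and reaches the boundary of
    [F] when [k = vmin F x]. *)
Definition shrink F k x : ptws V R :=
  fun v => (x v - k * (v \in F)%:R) / (1 - #|F|%:R * k).

Lemma shrink0 F x : shrink F 0 x = x.
Proof. by apply/funext => v; rewrite /shrink mulr0 mul0r !subr0 divr1. Qed.

Lemma geom_shrink F k x : (forall v, 0 <= x v) -> \sum_v x v = 1 ->
  supp x = F -> k <= vmin F x -> #|F|%:R * k < 1 ->
  [/\ forall v, 0 <= shrink F k x v, \sum_v shrink F k x v = 1 &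
      supp (shrink F k x) \subset F].
Proof.
move=> x0 x1 xF km Fk; have dk : 0 < 1 - #|F|%:R * k by rewrite subr_gt0.
have off v : v \notin F -> x v = 0.
  by rewrite -xF inE negbK => /eqP.
split.
- move=> v; rewrite divr_ge0 ?(ltW dk) // subr_ge0.
  case: (boolP (v \in F)) => vF; last by rewrite mulr0.
  by rewrite mulr1 (le_trans km) ?vmin_le.
- rewrite -mulr_suml sumrB x1 -mulr_sumr -natr_sum.
  rewrite -[X in X%:R](_ : #|F| = _) ?[k * _]mulrC ?mulfV ?gt_eqF //.
  by rewrite -sum1_card big_mkcond; apply: eq_bigr => v _; case: (v \in F).
- apply/fintype.subsetP => v; rewrite inE; apply: contraR => vF.
  by rewrite /shrink (negbTE vF) mulr0 off // subr0 mul0r.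
Qed.

(* On the facet F, the homotopy extension first dilates F from its barycentre;
   the points swept over the boundary of F then follow D. *)
Definition fill D F : R * ptws V R -> ptws V R := fun p =>
  let m := Order.max 0 (vmin F p.2) in
  D (Order.max 0 (p.1 - 2 * #|F|%:R * m),
     shrink F (Order.min m (Order.min p.1 1 / (2 * #|F|%:R))) p.2).

Lemma continuous_fill D F : F != finset.set0 -> continuous D -> continuous (fill D F).
Proof.
move=> F0 cD; have cm : continuous (fun p : R * ptws V R => Order.max 0 (vmin F p.2)).
  apply: continuous_maxr; first exact: continuous_cstr.
  apply: continuous_vmin => v.
  apply: (@continuous_compose _ _ _ snd (fun x : ptws V R => x v)).
    exact: continuous_snd.
  exact: continuous_coord.
have N0 : 0 < #|F|%:R :> R by rewrite ltr0n card_gt0.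
have ck : continuous (fun p : R * ptws V R => Order.min (Order.max 0 (vmin F p.2))
    (Order.min p.1 1 / (2 * #|F|%:R))).
  apply: continuous_minr => //; apply: continuous_mulr; last exact: continuous_cstr.
  by apply: continuous_minr; [exact: continuous_fst|exact: continuous_cstr].
apply: continuous_compose cD; apply: continuous_pair.
  apply: continuous_maxr; first exact: continuous_cstr.
  apply: continuous_subr; first exact: continuous_fst.
  by apply: continuous_mulr => //; exact: continuous_cstr.
apply: continuous_ptws => v; apply: continuous_divr.
- apply: continuous_subr.
    apply: (@continuous_compose _ _ _ snd (fun x : ptws V R => x v)).
      exact: continuous_snd.
    exact: continuous_coord.
  by apply: continuous_mulr => //; exact: continuous_cstr.
- apply: continuous_subr; first exact: continuous_cstr.
  by apply: continuous_mulr => //; exact: continuous_cstr.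
- move=> p; rewrite gt_eqF // subr_gt0.
  (* The factor 2 in [fill] keeps [#|F| * k] at most 1/2, so the denominator of [shrink] is at least
     1/2 at every ambient point and every time. *)
  set k := Order.min _ _; have : k <= 1 / (2 * #|F|%:R).
    rewrite ge_min; apply/orP; right.
    by rewrite ler_pM2r ?ge_min ?lexx ?orbT // invr_gt0 mulr_gt0.
  rewrite ler_pdivlMr ?mulr_gt0 //; lra.
Qed.

Lemma fill_vmin0 D F t x : vmin F x = 0 -> 0 <= t -> fill D F (t, x) = D (t, x).
Proof.
move=> m0 t0; rewrite /fill /= m0 maxxx mulr0 subr0 (max_r t0) min_l ?shrink0 //.
by rewrite divr_ge0 ?mulr_ge0 // le_min t0 ler01.
Qed.

(** With [m = vmin F x], a point of the open facet reaches the boundary at time [2 * #|F| * m],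
    exactly when the clock of [D] starts. Until then [D] is the identity, so it may be applied
    outside [L]; afterwards it is applied to points of [L]. On [L] itself [m = 0] and [fill] agrees
    with [D]. *)
Lemma contracts_fill D L A F a : is_simplicial_complex L -> A \subset L ->
  F != finset.set0 -> F \notin L ->
  (forall s, s \proper F -> s != finset.set0 -> s \in L) ->
  contracts D L A a -> contracts (fill D F) (F |: L)%SET A a.
Proof.
move=> [L0 Ld] /fintype.subsetP AL F0 FL FA [cD D0 DL DA D1].
have Lm x : geom L x -> vmin F x = 0.
  move=> /geom_realE[x0 x1 xL]; apply/eqP; apply: contraNT FL => m0.
  exact: Ld xL (vmin_supp x0 m0) F0.
have Am x : geom A x -> vmin F x = 0.
  by move=> /geom_realE[x0 x1 xA]; apply: Lm; apply/geom_realE; split => //; exact: AL.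
have LFL x : geom L x -> geom (F |: L)%SET x.
  by move=> /geom_realE[x0 x1 xL]; apply/geom_realE; split => //; apply/setU1P; right.
have N0 : 0 < #|F|%:R :> R by rewrite ltr0n card_gt0.
split.
- exact: continuous_fill.
- move=> x; rewrite /fill /= [Order.min 0 1]min_l // mul0r min_r ?le_max ?lexx //.
  by rewrite shrink0 max_l ?D0 // sub0r oppr_le0 !mulr_ge0 // le_max lexx.
- move=> t x t01 /geom_realE[x0 x1]; have /andP[t0 t1] := t01.
  rewrite !inE => /orP[/eqP xF|xL]; last first.
    have gx : geom L x by apply/geom_realE.
    by rewrite fill_vmin0 ?Lm //; apply/LFL/DL.
  have m0 := vmin_ge0 F x0.
  rewrite /fill /= (max_r m0) (min_l t1); set m := vmin F x; set N := #|F|%:R.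
  have N20 : 0 < 2 * N by rewrite mulr_gt0.
  have tN : t / (2 * N) * (2 * N) = t by rewrite mulfVK ?gt_eqF.
  have Nm0 : 0 <= N * m by rewrite mulr_ge0 // ltW.
  have [mt|mt] := leP m (t / (2 * N)).
    have mt2 : m * (2 * N) <= t by rewrite -ler_pdivlMr.
    have [|y0 y1 yF] := geom_shrink x0 x1 xF (lexx m); first by lra.
    apply/LFL/DL; first by rewrite max_r; lra.
    apply/geom_realE; split => //; apply: FA; last exact: supp_neq0.
    rewrite properE yF /=; apply/fintype.subsetPn.
    (* A vertex with minimal coordinate has dropped out of the support, so the point lies on a
       proper face of [F]. *)
    have [u uF mu] := vmin_eq F0 x0 x1; exists u => //.
    by rewrite inE negbK /shrink uF mulr1 /m mu subrr mul0r.
  have mt2 : t < m * (2 * N) by rewrite -ltr_pdivrMr.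
  rewrite max_l ?D0; last by lra.
  have [|y0 y1 yF] := geom_shrink (k := t / (2 * N)) x0 x1 xF (ltW mt); first by lra.
  apply/geom_realE; split => //; rewrite !inE -implyNb; apply/implyP => nyF.
  by apply: FA; [rewrite finset.properEneq nyF|exact: supp_neq0].
- by move=> t x /[dup] t01 /andP[t0 _] /[dup] Ax /Am m0; rewrite fill_vmin0 //; exact: DA.
- by move=> x /[dup] Ax /Am m0; rewrite fill_vmin0 ?ler01 //; exact: D1.
Qed.

Lemma contracts_facets A a (Fs : seq {set V}) : is_simplicial_complex A ->
  (exists D, contracts D A A a) -> uniq Fs ->
  (forall F, F \in Fs -> [/\ F != finset.set0, F \notin A &
     forall s, s \proper F -> s != finset.set0 -> s \in A]) ->
  exists D, contracts D (A :|: [set F in Fs])%SET A a.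
Proof.
move=> [A0 Ad] exD; elim: Fs => [_ _|F Fs IH /= /andP[FFs uFs] hF].
  have -> : (A :|: [set F in [::]] = A)%SET by apply/setP => s; rewrite !inE orbF.
  exact: exD.
have hF' G : G \in Fs -> [/\ G != finset.set0, G \notin A &
    forall s, s \proper G -> s != finset.set0 -> s \in A].
  by move=> GFs; apply: hF; rewrite inE GFs orbT.
have [D cD] := IH uFs hF'.
have [F0 FA Fp] := hF F (mem_head _ _).
exists (fill D F).
have -> : (A :|: [set G in F :: Fs] = F |: (A :|: [set G in Fs]))%SET.
  by apply/setP => s; rewrite !inE orbCA.
apply: contracts_fill cD => //.
- split; first by rewrite !inE (negbTE A0) /=; apply/negP => /hF' [/eqP].
  move=> s t; rewrite !inE => /orP[sA|sFs] ts t0; first by rewrite (Ad s).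
  have [->|nts] := eqVneq t s; first by rewrite sFs orbT.
  by have [_ _ -> //] := hF' s sFs; rewrite finset.properEneq nts.
- exact: finset.subsetUl.
- by rewrite !inE (negbTE FA).
- by move=> s sF s0; rewrite !inE Fp.
Qed.

Definition vertex_pt v : ptws V R := fun w => (w == v)%:R.

Lemma geom_vertex v x : geom [set [set v]]%SET x -> x = vertex_pt v.
Proof.
move=> /geom_realE[x0 x1]; rewrite inE => /eqP xv.
have off w : w != v -> x w = 0.
  move=> wv; apply/eqP; apply: contraNT wv => xw.
  by have : w \in supp x; [rewrite inE|rewrite xv inE].
apply/funext => w; rewrite /vertex_pt; have [->|/off //] := eqVneq w v.
by rewrite -x1 (bigD1 v) //= big1 ?addr0.
Qed.

Lemma contracts_vertex A v : deforms (geom A) (geom [set [set v]]%SET) ->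
  exists D, contracts D A A (vertex_pt v).
Proof.
move=> [_ [D [cD D0 DA D1] _]]; exists D; split => // x Ax.
by apply: geom_vertex; exact: D1.
Qed.

(** The condition on the support is closed: it says that [vmin s] vanishes for each nonempty [s]
    outside [L]. The realization is therefore closed in a cube. *)
Lemma compact_geom L : is_simplicial_complex L -> compact (geom L).
Proof.
move=> [L0 Ld]; pose cube : set (ptws V R) := [set x | forall v, `[0, 1]%classic (x v)].
have cc : compact cube 
  by apply: (@tychonoff V (fun=> R) (fun=> `[0, 1]%classic)) => v; exact: segment_compact.
have csum : continuous (fun x : ptws V R => \sum_v x v).
  by apply: continuous_sumr => v; exact: continuous_coord.
have cvm s : continuous (fun x : ptws V R => vmin s x).
  by apply: continuous_vmin => v; exact: continuous_coord.
rewrite (_ : geom L = cube `&` ((fun x => \sum_v x v) @^-1` [set 1] `&`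
  \bigcap_(s in [set s | (s != finset.set0) && (s \notin L)]) (vmin s @^-1` [set 0]))).
  apply: compact_closedI => //; apply: closedI.
    by apply: preimage_closed; [move=> x _; exact: csum|exact: closed_eq].
  apply: closed_bigI => s _.
  by apply: preimage_closed; [move=> x _; exact: cvm|exact: closed_eq].
rewrite eqEsubset; split => x.
  move=> /geom_realE[x0 x1 xL]; split.
    by move=> v; rewrite /= in_itv /= x0 coord_le1.
  split => // s /= /andP[s0 sL]; apply/eqP; apply: contraNT sL => m0.
  exact: Ld xL (vmin_supp x0 m0) s0.
move=> [xc [x1 xm]]; have x0 v : 0 <= x v.
  by have := xc v; rewrite /= in_itv /= => /andP[].
apply/geom_realE; split => //; apply: contraT => xL.
have := xm (supp x); rewrite /= (supp_neq0 x1) xL => /(_ isT)/eqP.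
by rewrite (negbTE (supp_vmin _ x0 x1 _)) ?supp_neq0.
Qed.

End Contraction.

(** * Collapsing a contractible subcomplex *)

Lemma hausdorff_pair (X Y : topologicalType) :
  hausdorff_space X -> hausdorff_space Y -> hausdorff_space (X * Y)%type.
Proof.
move=> hX hY [x1 y1] [x2 y2] cl; congr pair.
  apply: hX => U W nU nW; have [||[z t] [/= ? ?]] := cl (fst @^-1` U) (fst @^-1` W).
  - exact: (@continuous_fst X Y (x1, y1)).
  - exact: (@continuous_fst X Y (x2, y2)).
  by exists z.
apply: hY => U W nU nW; have [||[z t] [/= ? ?]] := cl (snd @^-1` U) (snd @^-1` W).
- exact: (@continuous_snd X Y (x1, y1)).
- exact: (@continuous_snd X Y (x2, y2)).
by exists t.
Qed.

(* A continuous surjection from a compact space onto a Hausdorff one is closed,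
   hence a quotient map. *)
Lemma compact_quotient_lift (X W Y : topologicalType) (p : X -> W) (f : X -> Y) :
  compact [set: X] -> hausdorff_space W -> continuous p ->
  (forall w, exists x, p x = w) -> continuous f ->
  (forall x y, p x = p y -> f x = f y) ->
  exists2 g : W -> Y, continuous g & forall x, g (p x) = f x.
Proof.
move=> cX hW cp sp cf pf; have [s sK] := choice sp.
exists (f \o s) => [|x]; last by apply: pf; rewrite sK.
apply/continuous_closedP => C cC.
have -> : (f \o s) @^-1` C = p @` (f @^-1` C).
  rewrite eqEsubset; split => [w Cw|_ [x Cx <-]]; first by exists (s w).
  by rewrite /preimage /= (pf (s (p x)) x) ?sK.
apply: compact_closed => //; apply: continuous_compact.
  exact: continuous_subspaceT.
by apply: (subclosed_compact _ cX) => //; move/continuous_closedP: cf; apply.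
Qed.

Section Collapse.
Context {R : realType} {V : finType}.
Local Notation geom := (@geom_real R V).
Local Notation I := (set_type (@unit_interval R)).

Lemma compact_unit_interval : compact [set: I].
Proof.
apply: compact_set_type; rewrite (_ : @unit_interval R = `[0, 1]%classic).
  exact: segment_compact.
by apply/seteqP; split => t; rewrite /unit_interval /= in_itv.
Qed.

Lemma unit_intervalP (t : I) : 0 <= set_val t <= 1.
Proof. by case: t => t tI; have := set_mem tI. Qed.

Lemma unit_interval_onem (t : I) : 0 <= 1 - set_val t <= 1.
Proof. by have := unit_intervalP t; lra. Qed.

(** The hypotheses on [p] say that [W] is [L/A]. The end [k] of the contraction is constant on [A],
    hence factors through [p] as [g]. The equivalence is [p] after the retraction of [M] onto [L],
    and its inverse is [g] followed by the inclusion. *)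
Lemma homotopy_equivalent_collapse (W : topologicalType) (M L A : {set {set V}})
    D (a : ptws V R) (p : set_type (geom L) -> W) :
  deforms (geom M) (geom L) -> is_simplicial_complex L -> contracts D L A a ->
  hausdorff_space W -> continuous p -> (forall w, exists x, p x = w) ->
  (forall x y, geom A (set_val x) -> geom A (set_val y) -> p x = p y) ->
  (forall x y, p x = p y ->
     x = y \/ geom A (set_val x) /\ geom A (set_val y)) ->
  homotopy_equivalent R (realization R M) W.
Proof.
move=> [LM [D1 [cD1 D10 D1M D1L] D1fix]] cxL [cD D0 DL DA Da] hW cp sp pA pinj.
have i01 : 0 <= (1 : R) <= 1 by rewrite ler01 lexx.
have Mval (x : set_type (geom M)) : geom M (set_val x).
  by case: x => x xM; exact: set_mem xM.
have Lval (x : set_type (geom L)) : geom L (set_val x).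
  by case: x => x xL; exact: set_mem xL.
pose r (x : set_type (geom M)) : set_type (geom L) :=
  exist _ (D1 (1, set_val x)) (mem_set (D1L _ (Mval x))).
(* Time is reversed here and in [E]: [D] starts at the identity, whereas the required homotopies end
   there. *)
pose K (q : I * set_type (geom L)) : set_type (geom L) := exist _
  (D (1 - set_val q.1, set_val q.2))
  (mem_set (DL _ _ (unit_interval_onem q.1) (Lval q.2))).
have [cE0 E0 EM _] : deformation (concat D1 D) (geom M) setT.
  by apply: (deformation_concat LM) => //; split => //.
pose E (q : I * set_type (geom M)) : set_type (geom M) := exist _
  (concat D1 D (1 - set_val q.1, set_val q.2))
  (mem_set (EM _ _ (unit_interval_onem q.1) (Mval q.2))).
pose incl (x : set_type (geom L)) : set_type (geom M) :=
  exist _ (set_val x) (mem_set (LM _ (Lval x))).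
pose k (x : set_type (geom L)) : set_type (geom L) :=
  exist _ (D (1, set_val x)) (mem_set (DL _ _ i01 (Lval x))).
have conem (X : topologicalType) (B : set X) :
    continuous (fun q : I * set_type B => (1 - set_val q.1 : R, set_val q.2)).
  apply: continuous_pair.
    apply: continuous_subr; first exact: continuous_cstr.
    exact: continuous_compose continuous_fst (@continuous_set_val _ _).
  exact: continuous_compose continuous_snd (@continuous_set_val _ _).
have cone (X : topologicalType) (B : set X) :
    continuous (fun x : set_type B => (1 : R, set_val x)).
  by apply: continuous_pair; [exact: continuous_cstr|exact: continuous_set_val].
have cr : continuous r.
  by apply: continuous_into_set; exact: continuous_compose (cone _ _) cD1.
have ck : continuous k.
  by apply: continuous_into_set; exact: continuous_compose (cone _ _) cD.
have cK : continuous K.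
  by apply: continuous_into_set; exact: continuous_compose (conem _ _) cD.
have cE : continuous E.
  by apply: continuous_into_set; exact: continuous_compose (conem _ _) cE0.
have cincl : continuous incl.
  by apply: continuous_into_set; exact: continuous_set_val.
have cL : compact [set: set_type (geom L)].
  by apply: compact_set_type; exact: compact_geom.
have ri x : r (incl x) = x.
  by apply: val_inj; exact: (D1fix _ _ i01 (Lval x)).
have kA x : geom A (set_val x) -> set_val (k x) = a by exact: Da.
have [g cg gp] : exists2 g : W -> set_type (geom L), continuous g &
    forall x, g (p x) = k x.
  apply: compact_quotient_lift => // x y /pinj[->//|[Ax Ay]].
  by apply: val_inj; rewrite [LHS]kA // [RHS]kA.
(* The product of [p] with the unit interval is again a surjection from a compact space onto a
   Hausdorff one, hence a quotient map, so the homotopy descends as well. *)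
have [G cG GpK] : exists2 G : I * W -> W, continuous G &
    forall q, G (q.1, p q.2) = p (K q).
  apply: (@compact_quotient_lift (I * set_type (geom L))%type (I * W)%type W
    (fun q => (q.1, p q.2)) (p \o K)).
  - by rewrite -setXTT; apply: compact_setX => //; exact: compact_unit_interval.
  - apply: hausdorff_pair => //; apply: hausdorff_set_type; exact: norm_hausdorff.
  - apply: continuous_pair; first exact: continuous_fst.
    exact: continuous_compose continuous_snd cp.
  - by move=> [t w]; have [x <-] := sp w; exists (t, x).
  - exact: continuous_compose cK cp.
  - move=> [t x] [s y] [-> /pinj[->//|[Ax Ay]]].
    by apply: pA; apply: DA => //; exact: unit_interval_onem.
exists (p \o r), (incl \o g); split.
- exact: continuous_compose cr cp.
- exact: continuous_compose cg cincl.
- exists E; split => //; split => t x t01; apply: val_inj; rewrite /= t01.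
    by rewrite subr0 concat1 gp.
  by rewrite subrr concat0.
- exists G; split => //; split => t w t01; have [x <-] := sp w.
    rewrite (GpK (t, x)) /= gp ri; congr p; apply: val_inj.
    by rewrite /= t01 subr0.
  by rewrite (GpK (t, x)); congr p; apply: val_inj; rewrite /= t01 subrr D0.
Qed.

End Collapse.

(** * From simplices to spheres *)

Section SimplexToSphere.
Context {R : realType} {V : finType} {n : nat}.
Implicit Types (e : 'I_n.+1 -> V) (x y : ptws V R).

Definition face e : {set V} := [set e i | i : 'I_n.+1]%SET.

Lemma face_neq0 e : face e != finset.set0.
Proof. by apply/set0Pn; exists (e ord0); apply: imset_f. Qed.

Lemma mem_face e i : e i \in face e.
Proof. exact: imset_f. Qed.

Definition offsum e x : R := \sum_(v | v \notin face e) x v.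

(** The term [offsum] keeps the denominator of [sphere_map] positive on the whole simplex: if the
    spread and [vmin] both vanish, all coordinates are 0, against their sum being 1. On the open
    facets, where [vmin] is nonzero, it vanishes and leaves the squared distance of the
    stereographic formula. *)
Definition spread e x : R := \sum_i (x (e i) - x (e ord0)) ^+ 2 + offsum e x ^+ 2.

(* Inverse stereographic projection of the point with coordinates
   (x (e i) - x (e 0)) / m, where m = vmin (face e) x, with denominators
   cleared so that it extends to the boundary of the simplex. *)
Definition sphere_map e x : ptws 'I_n.+1 R := fun i =>
  (if i == ord0 then spread e x - vmin (face e) x ^+ 2
   else 2 * vmin (face e) x * (x (e i) - x (e ord0)))
  / (spread e x + vmin (face e) x ^+ 2).

Section Point.
Variables (e : 'I_n.+1 -> V) (x : ptws V R).
Hypotheses (inje : injective e) (x0 : forall v, 0 <= x v) (x1 : \sum_v x v = 1).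

Lemma spread_ge0 : 0 <= spread e x.
Proof. by rewrite addr_ge0 ?sqr_ge0 // sumr_ge0 // => i _; rewrite sqr_ge0. Qed.

Lemma sum_face : \sum_i x (e i) + offsum e x = 1.
Proof.
rewrite -x1 (bigID (mem (face e))) /=; congr (_ + _).
by rewrite big_imset //= => i j _ _; exact: inje.
Qed.

Lemma denom_gt0 : 0 < spread e x + vmin (face e) x ^+ 2.
Proof.
rewrite lt_neqAle addr_ge0 ?spread_ge0 ?sqr_ge0 // andbT eq_sym.
rewrite paddr_eq0 ?spread_ge0 ?sqr_ge0 // /spread paddr_eq0 ?sqr_ge0 //; last first.
  by rewrite sumr_ge0 // => i _; rewrite sqr_ge0.
rewrite !sqrf_eq0; apply/negP => /andP[/andP[/eqP d0 /eqP o0] /eqP m0].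
have d i : x (e i) = x (e ord0).
  have /psumr_eq0P := d0; move/(_ (fun i _ => sqr_ge0 _))/(_ i isT)/eqP.
  by rewrite sqrf_eq0 subr_eq0 => /eqP.
have [_ /imsetP[j _ ->] mj] := vmin_eq (face_neq0 e) x0 x1.
have := sum_face; rewrite o0 big1 ?addr0 => [/eqP|i _].
  by rewrite eq_sym oner_eq0.
by rewrite d -(d j) -mj.
Qed.

Lemma sphere_map_boundary : vmin (face e) x = 0 -> sphere_map e x = @sphere_base R n.
Proof.
move=> m0; apply/funext => i; rewrite /sphere_map /sphere_base m0.
have := denom_gt0; rewrite m0 expr0n addr0 subr0 mulr0 mul0r => d0.
by case: ifP => _; rewrite ?mul0r // divff ?gt_eqF.
Qed.

Lemma spread_recl : spread e x =
  \sum_(i < n) (x (e (lift ord0 i)) - x (e ord0)) ^+ 2 + offsum e x ^+ 2.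
Proof. by rewrite /spread big_ord_recl subrr expr0n add0r. Qed.

(** With [S] the denominator, [m = vmin] and [o = offsum], the squares of the numerators add up to
    [S^2 - 4 m^2 o^2], so the norm is 1 as soon as [m o = 0]. *)
Lemma sphere_map_in : (vmin (face e) x != 0 -> offsum e x = 0) ->
  @sphere R n (sphere_map e x).
Proof.
move=> mo; have := denom_gt0; rewrite /sphere /= big_ord_recl /sphere_map eqxx.
set S := spread e x + _ => S0.
under eq_bigr => i _ do rewrite eq_sym (negbTE (neq_lift ord0 i)) mulrAC exprMn.
rewrite -mulr_sumr; set m := vmin _ _; set Q := \sum_i _.
have Sne : S != 0 by rewrite gt_eqF.
have eS : spread e x = S - m ^+ 2 by rewrite /S addrK.
have eQ : Q = S - m ^+ 2 - offsum e x ^+ 2 by rewrite -eS spread_recl addrK.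
have mo0 : m * offsum e x = 0.
  by have [->|/mo ->] := eqVneq m 0; rewrite ?mul0r ?mulr0.
rewrite eQ eS; have -> : (2 * m / S) ^+ 2 * (S - m ^+ 2 - offsum e x ^+ 2) =
  (4 * m ^+ 2 * (S - m ^+ 2) - 4 * (m * offsum e x) ^+ 2) / S ^+ 2 by field.
by rewrite mo0; field.
Qed.

Lemma sphere_map_ord0 : 1 - sphere_map e x ord0 =
  2 * vmin (face e) x ^+ 2 / (spread e x + vmin (face e) x ^+ 2).
Proof. by rewrite /sphere_map eqxx; field; rewrite gt_eqF ?denom_gt0. Qed.

Lemma sphere_map_base : sphere_map e x = @sphere_base R n -> vmin (face e) x = 0.
Proof.
move=> /(congr1 (fun y : 'I_n.+1 -> R => 1 - y ord0)).
rewrite sphere_map_ord0 /sphere_base eqxx subrr.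
move/eqP; rewrite mulf_eq0 invr_eq0 (gt_eqF denom_gt0) orbF mulf_eq0 sqrf_eq0.
by rewrite pnatr_eq0 => /eqP.
Qed.

(** Stereographic projection from the base point recovers the affine coordinates. *)
Lemma sphere_map_ratio i : vmin (face e) x != 0 ->
  (x (e i) - x (e ord0)) / vmin (face e) x =
  (if i == ord0 then 0 else sphere_map e x i / (1 - sphere_map e x ord0)).
Proof.
move=> m0; case: eqP => [->|/eqP/negbTE i0]; first by rewrite subrr mul0r.
rewrite sphere_map_ord0 /sphere_map i0; field.
by rewrite m0 gt_eqF ?denom_gt0.
Qed.

End Point.

(** The image determines the differences [d i] of the coordinates divided by [m = vmin]. The
    rescaled coordinates [x (e i) / m] are [c + d i] and have minimum 1, which fixes [c]; the sum 1
    then fixes [m]. *)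
Lemma sphere_map_inj e x y : injective e ->
  (forall v, 0 <= x v) -> \sum_v x v = 1 -> supp x = face e ->
  (forall v, 0 <= y v) -> \sum_v y v = 1 -> supp y = face e ->
  sphere_map e x = sphere_map e y -> x = y.
Proof.
move=> inje x0 x1 xF y0 y1 yF exy.
have aux z : (forall v, 0 <= z v) -> \sum_v z v = 1 -> supp z = face e ->
    0 < vmin (face e) z /\ offsum e z = 0.
  move=> z0 z1 zF; split.
    by rewrite lt_neqAle vmin_ge0 // andbT eq_sym supp_vmin ?face_neq0 // zF.
  by apply: big1 => v; rewrite -zF inE negbK => /eqP.
have [mx ox] := aux x x0 x1 xF; have [my oy] := aux y y0 y1 yF.
set m := vmin (face e) x in mx; set m' := vmin (face e) y in my.
pose c (z : ptws V R) := z (e ord0) / vmin (face e) z.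
pose d i : R := if i == ord0 then 0 else
  sphere_map e x i / (1 - sphere_map e x ord0).
have coord z i : (forall v, 0 <= z v) -> \sum_v z v = 1 ->
    0 < vmin (face e) z -> sphere_map e x = sphere_map e z ->
    z (e i) = vmin (face e) z * (c z + d i).
  move=> z0 z1 mz ez; have := sphere_map_ratio inje z0 z1 i.
  rewrite -ez -/(d i) /c => /(_ (lt0r_neq0 mz)) <-.
  by field; rewrite gt_eqF.
have cmax z : (forall v, 0 <= z v) -> \sum_v z v = 1 ->
    0 < vmin (face e) z -> sphere_map e x = sphere_map e z ->
    (forall i, 1 <= c z + d i) /\ exists i, c z + d i = 1.
  move=> z0 z1 mz ez; split => [i|].
    rewrite -(ler_pM2l mz) mulr1 -coord //; apply: vmin_le; exact: mem_face.
  have [_ /imsetP[j _ ->] mj] := vmin_eq (face_neq0 e) z0 z1.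
  exists j; apply: (mulfI (lt0r_neq0 mz)); rewrite mulr1 -coord //.
have cxy : c x = c y.
  have [cx [i ci]] := cmax x x0 x1 mx erefl.
  have [cy [j cj]] := cmax y y0 y1 my exy.
  by have := cx j; have := cy i; lra.
have sx := sum_face inje x1; have sy := sum_face inje y1.
have mm : m = m'.
  move: sx sy; rewrite ox oy !addr0.
  rewrite (eq_bigr _ (fun i _ => coord x i x0 x1 mx erefl)).
  rewrite (eq_bigr _ (fun i _ => coord y i y0 y1 my exy)).
  rewrite -!mulr_sumr cxy -/m -/m'; set s := \sum_i _ => ms ms'.
  have s0 : s != 0 by apply: contra_eq_neq ms => ->; rewrite mulr0 eq_sym oner_eq0.
  by apply: (mulIf s0); rewrite ms ms'.
apply/funext => v; have [/imsetP[i _ ->]|] := boolP (v \in face e).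
  by rewrite (coord x) // (coord y) // cxy -/m mm.
move=> vF; have := vF; rewrite -{1}xF inE negbK => /eqP ->.
by move: vF; rewrite -yF inE negbK => /eqP ->.
Qed.

(** The argument for injectivity run backwards: project [s] stereographically to [d], translate so
    that the minimum of [c] is 1, and divide by the sum of the [c i]. The least coordinate of the
    resulting point is [m]. *)
Lemma sphere_map_surj e s : injective e -> @sphere R n s -> s <> @sphere_base R n ->
  exists x, [/\ forall v, 0 <= x v, \sum_v x v = 1, supp x = face e &
    sphere_map e x = s].
Proof.
move=> inje ss sb; have s1 : s ord0 ^+ 2 + \sum_(i < n) s (lift ord0 i) ^+ 2 = 1.
  by move: ss; rewrite /sphere /= big_ord_recl.
have q0 : 0 <= \sum_(i < n) s (lift ord0 i) ^+ 2.
  by apply: sumr_ge0 => i _; rewrite sqr_ge0.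
have s0 : s ord0 < 1.
  rewrite lt_neqAle; apply/andP; split; last by nra.
  apply/eqP => s01; apply: sb; apply/funext => i; rewrite /sphere_base.
  case: (unliftP ord0 i) => [j ->|->]; last by rewrite eqxx.
  rewrite eq_sym (negbTE (neq_lift ord0 j)).
  have /psumr_eq0P : \sum_(i < n) s (lift ord0 i) ^+ 2 = 0.
    by move: s1; rewrite s01 expr1n; lra.
  move/(_ (fun i _ => sqr_ge0 _))/(_ j isT)/eqP.
  by rewrite sqrf_eq0 => /eqP.
pose d i : R := if i == ord0 then 0 else s i / (1 - s ord0).
have [j jmin] : exists j, forall i, d j <= d i.
  by exists [arg min_(i < ord0) d i]%O; case: arg_minP => // i _ h k; exact: h.
pose c i := 1 - d j + d i.
have c1 i : 1 <= c i by have := jmin i; rewrite /c; lra.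
pose m : R := (\sum_i c i)^-1.
have sc : 0 < \sum_i c i.
  apply: (@lt_le_trans _ _ (\sum_(i < n.+1) 1)).
    by rewrite sumr_const card_ord ltr0n.
  by apply: ler_sum.
have m0 : 0 < m by rewrite invr_gt0.
pose x : ptws V R := fun v => \sum_i (m * c i) *+ (v == e i).
have xe i : x (e i) = m * c i.
  rewrite /x (bigD1 i) //= eqxx big1 ?addr0 // => k ki.
  by rewrite (inj_eq inje) eq_sym (negbTE ki).
have xoff v : v \notin face e -> x v = 0.
  move=> vF; rewrite /x big1 // => i _; case: eqP => // vi.
  by move: vF; rewrite vi mem_face.
have x1 : \sum_v x v = 1.
  rewrite (bigID (mem (face e))) /= [X in _ + X]big1 ?addr0 //.
  rewrite big_imset /=; last by move=> i k _ _; exact: inje.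
  by rewrite (eq_bigr _ (fun i _ => xe i)) -mulr_sumr mulVf // gt_eqF.
have x0 v : 0 <= x v.
  have [/imsetP[i _ ->]|/xoff -> //] := boolP (v \in face e).
  by rewrite xe mulr_ge0 ?(ltW m0) // (le_trans ler01).
have xm : vmin (face e) x = m.
  apply/eqP; rewrite eq_le; apply/andP; split.
    have -> : m = x (e j) by rewrite xe /c subrK mulr1.
    by apply: vmin_le; exact: mem_face.
  have [_ /imsetP[k _ ->] ->] := vmin_eq (face_neq0 e) x0 x1.
  by rewrite xe ler_peMr ?(ltW m0).
have xo : offsum e x = 0 by apply: big1.
have dx i : x (e i) - x (e ord0) = m * d i.
  by rewrite !xe -mulrBr /c /d eqxx; congr (_ * _); ring.
have s0' : 1 - s ord0 != 0 by rewrite gt_eqF // subr_gt0.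
have xs : spread e x = m ^+ 2 * (1 + s ord0) / (1 - s ord0).
  rewrite spread_recl xo expr0n addr0.
  under eq_bigr => i _ do rewrite dx /d eq_sym (negbTE (neq_lift ord0 i)) !exprMn.
  rewrite -mulr_sumr -mulr_suml.
  have -> : \sum_(i < n) s (lift ord0 i) ^+ 2 = (1 - s ord0) * (1 + s ord0).
    by apply: (@addrI _ (s ord0 ^+ 2)); rewrite s1; ring.
  by field; exact: s0'.
exists x; split => //.
  apply/setP => v; rewrite inE; have [/imsetP[i _ ->]|/xoff ->] := boolP (v \in face e).
    by rewrite xe gt_eqF // mulr_gt0 // (lt_le_trans ltr01).
  by rewrite eqxx.
have mne : m ^+ 2 * (1 + s ord0) + m ^+ 2 * (1 - s ord0) != 0.
  have -> : m ^+ 2 * (1 + s ord0) + m ^+ 2 * (1 - s ord0) = 2 * m ^+ 2 by ring.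
  by rewrite gt_eqF // mulr_gt0 ?exprn_gt0.
apply/funext => i; rewrite /sphere_map xm xs dx /d; case: eqP => [->|_].
  by field; rewrite s0' mne.
by field; rewrite s0' mne.
Qed.

End SimplexToSphere.

(** The map from the wedge to the product separates the points: coordinate [i] differs from the base
    point only on the image of the summand [i]. *)
Lemma wedge_lift_inj {I : choiceType} (X : I -> topologicalType)
    (p0 : forall i, X i) i (x : X i) j (y : X j) :
  x <> p0 i -> wedge_lift p0 x = wedge_lift p0 y -> existT X i x = existT X j y.
Proof.
move=> xp /(congr1 (@wedge_prod _ _ p0)).
rewrite /wedge_prod !wedge_lift_funE; try exact: wedge_prod_pointE.
move=> /(congr1 (fun f => f i)); rewrite dfwithin.
have [E|ij] := eqVneq j i; last by rewrite dfwithout.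
by case: _ / E x xp => x xp; rewrite dfwithin => ->.
Qed.

(** * The quotient map from L onto the wedge of spheres *)

Section WedgeMap.
Context {R : realType} {V : finType} {n k : nat}.
Variables (e : 'I_k.+1 -> 'I_n.+1 -> V) (L : {set {set V}}).
Hypotheses (cxL : is_simplicial_complex L) (inje : forall i, injective (e i))
  (injF : injective (fun i => face (e i))) (FL : forall i, face (e i) \in L)
  (Fmax : forall i s, s \in L -> face (e i) \subset s -> s = face (e i)).
Local Notation geom := (@geom_real R V).
Local Notation SX := (set_type (geom L)).
Local Notation W := (wedge_spheres R k.+1 n).
Local Notation m i x := (vmin (face (e i)) (set_val x)).

Local Notation wl i :=
  (@wedge_lift 'I_k.+1 (fun=> sphere_space R n) (fun=> sphere_pt R n) i).

Let A : {set {set V}} := (L :\: [set face (e i) | i : 'I_k.+1])%SET.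

Lemma geomP (x : SX) : [/\ forall v, 0 <= set_val x v, \sum_v set_val x v = 1 &
  supp (set_val x) \in L].
Proof. by case: x => x xL; apply/geom_realE; exact: set_mem xL. Qed.

Lemma vmin_facet i (x : SX) : m i x != 0 -> supp (set_val x) = face (e i).
Proof. by have [x0 x1 xL] := geomP x; move=> /(vmin_supp x0); exact: Fmax. Qed.

Lemma vmin_facet_uniq i j (x : SX) : m i x != 0 -> m j x != 0 -> i = j.
Proof. by move=> /vmin_facet xi /vmin_facet xj; apply: injF; rewrite -xi. Qed.

Lemma offsum_facet i (x : SX) : m i x != 0 -> offsum (e i) (set_val x) = 0.
Proof.
by move=> /vmin_facet xi; apply: big1 => v; rewrite -xi inE negbK => /eqP.
Qed.

Definition facet_map i (x : SX) : sphere_space R n :=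
  exist _ (sphere_map (e i) (set_val x))
    (mem_set (let: And3 x0 x1 _ := geomP x in
      sphere_map_in (@inje i) x0 x1 (@offsum_facet i x))).

Lemma continuous_facet_map i : continuous (facet_map i).
Proof.
have cx v : continuous (fun x : SX => set_val x v).
  apply: (@continuous_compose _ _ _ set_val (fun x : ptws V R => x v)).
    exact: continuous_set_val.
  exact: continuous_coord.
have cm : continuous (fun x : SX => m i x) by exact: continuous_vmin.
have csq (f : SX -> R) : continuous f -> continuous (fun x => f x ^+ 2).
  by move=> cf; exact: continuous_mulr.
have cs : continuous (fun x : SX => spread (e i) (set_val x)).
  apply: continuous_addr; last by apply: csq; exact: continuous_sumr.
  by apply: continuous_sumr => j; apply: csq; exact: continuous_subr.
apply: continuous_into_set; apply: continuous_ptws => j.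
apply: continuous_divr; last 2 first.
- by apply: continuous_addr => //; exact: csq.
- by move=> x; have [x0 x1 _] := geomP x; rewrite gt_eqF // denom_gt0.
case: eqP => _; first by apply: continuous_subr => //; exact: csq.
apply: continuous_mulr; last exact: continuous_subr.
by apply: continuous_mulr => //; exact: continuous_cstr.
Qed.

Lemma facet_map_base i x : facet_map i x = sphere_pt R n <-> m i x = 0.
Proof.
have [x0 x1 _] := geomP x; split.
  by move=> /(congr1 val) /=; exact: sphere_map_base.
by move=> m0; apply: val_inj; exact: sphere_map_boundary.
Qed.

Definition active (x : SX) : 'I_k.+1 := odflt ord0 [pick i | m i x != 0].

Definition collapse (x : SX) : W := wl (active x) (facet_map (active x) x).

Lemma active_eq i x : m i x != 0 -> active x = i.
Proof.
rewrite /active; case: pickP => [j mj mi|/(_ i) -> //].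
exact: vmin_facet_uniq mj mi.
Qed.

(** If no facet is active, every facet map gives the base point, and the base points of all summands
    are identified in the wedge; the default index in [active] is thus immaterial. *)
Lemma collapseE i x : (forall j, j != i -> m j x = 0) ->
  collapse x = wl i (facet_map i x).
Proof.
move=> mj; have [mi|mi] := eqVneq (m i x) 0; last by rewrite /collapse (active_eq mi).
have m0 j : m j x = 0 by have [->//|/mj] := eqVneq j i.
rewrite /collapse; have /facet_map_base -> := m0 (active x).
have /facet_map_base -> := m0 i.
exact: (@wedge_liftE _ (fun=> sphere_space R n) _ i (sphere_pt R n) _ (sphere_pt R n)).
Qed.

(** The closed sets [C i], on which only facet [i] can be active, form a finite cover, because the
    open facets are disjoint. On [C i] the map is the continuous facet map into summand [i]. *)
Lemma continuous_collapse : continuous collapse.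
Proof.
pose C i : set SX := \bigcap_(j in [set j | j != i]) [set x : SX | m j x = 0].
have cC i : closed (C i).
  apply: closed_bigI => j _; apply: (@preimage_closed _ _ (fun x : SX => m j x) [set 0]).
    move=> x _; apply: continuous_vmin => v.
    apply: (@continuous_compose _ _ _ set_val (fun x : ptws V R => x v)).
      exact: continuous_set_val.
    exact: continuous_coord.
  exact: closed_eq.
apply/continuous_closedP => Z cZ.
rewrite (_ : _ @^-1` _ = \bigcup_(i in [set: 'I_k.+1])
    (C i `&` (fun x => wl i (facet_map i x) : W) @^-1` Z)).
  apply: closed_bigcup => [|i _]; first exact: finite_finset.
  apply: closedI => //.
  have /continuous_closedP : continuous (fun x => wl i (facet_map i x) : W).
    apply: continuous_compose (@continuous_facet_map i) _.
    exact: (@wedge_lift_continuous _ (fun=> sphere_space R n) (fun=> sphere_pt R n) i).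
  exact.
rewrite eqEsubset; split => x.
  move=> Zx; exists (active x) => //; split; last exact: Zx.
  move=> j /= jx; apply/eqP; apply: contraNT jx => mj.
  by rewrite (active_eq mj).
by move=> [i _ [Cx]]; rewrite /preimage /= (@collapseE i) // => j /Cx.
Qed.

Lemma subcomplexP (x : SX) : geom A (set_val x) <-> forall i, m i x = 0.
Proof.
have [x0 x1 xL] := geomP x; split => [/geom_realE[_ _ /setDP[_ xA]] i|m0].
  apply/eqP; apply: contraNT xA => mi; apply/imsetP; exists i => //.
  exact: vmin_facet.
apply/geom_realE; split => //; apply/setDP; split => //; apply/imsetP => -[i _ xi].
by have := supp_vmin (face_neq0 (e i)) x0 x1; rewrite xi subxx m0 eqxx => /(_ isT).
Qed.

Lemma facet_complement_complex : is_simplicial_complex A.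
Proof.
have [L0 Ld] := cxL.
split=> [|s t /setDP[sL sF] ts t0]; first by rewrite !inE (negbTE L0) andbF.
apply/setDP; split; first exact: Ld ts t0.
apply: contra sF => /imsetP[i _ ti]; apply/imsetP; exists i => //.
by apply: Fmax => //; rewrite -ti.
Qed.

Lemma homotopy_equivalent_wedge M v : deforms (geom M) (geom L) ->
  deforms (geom A) (geom [set [set v]]%SET) ->
  homotopy_equivalent R (realization R M) W.
Proof.
move=> dML dA; have [D cD] := contracts_vertex dA.
have [L0 Ld] := cxL.
have cxA := facet_complement_complex.
have [|||D' cD'] := @contracts_facets R V A (vertex_pt v)
  [seq face (e i) | i : 'I_k.+1] cxA.
- by exists D; exact: cD.
- by rewrite map_inj_uniq ?enum_uniq.
- move=> _ /mapP[i _ ->]; split; first exact: face_neq0.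
    by rewrite !inE; apply/negP => /andP[+ _]; apply/negP; rewrite negbK; exact: imset_f.
  move=> s sF s0; apply/setDP; split; first by apply: Ld s0; [exact: FL|exact: proper_sub].
  apply/imsetP => -[j _ sj]; have := @Fmax j _ (FL i); rewrite -sj proper_sub //.
  by move=> /(_ isT) Fs; move: sF; rewrite Fs fintype.properxx.
have LA : (A :|: [set F in [seq face (e i) | i : 'I_k.+1]])%SET = L.
  apply/setP => s; rewrite !inE; apply/idP/idP.
    by case/orP => [/andP[] //|/mapP[i _ ->]]; exact: FL.
  move=> ->; rewrite andbT orbC; case: imsetP => [[i _ ->]|_]; last by rewrite orbT.
  by rewrite orbF; apply/mapP; exists i; rewrite ?mem_enum.
rewrite LA in cD'.
have vA : geom A (vertex_pt v).
  have [vAsub _] := dA; apply: vAsub; apply/geom_realE; split.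
  - by move=> w; rewrite ler0n.
  - rewrite (bigD1 v) //= /vertex_pt eqxx big1 ?addr0 // => w /negbTE -> //.
  - rewrite inE; apply/eqP/setP => w; rewrite !inE /vertex_pt.
    by rewrite pnatr_eq0 eqb0 negbK.
apply: (homotopy_equivalent_collapse (A := A) (p := collapse) dML cxL cD').
- apply: wedge_hausdorff => _; apply: hausdorff_set_type; exact: hausdorff_ptws.
- exact: continuous_collapse.
- move=> w; have [i _ [s _ <-]] : (\bigcup_i wl i @` setT) w.
    by rewrite wedgeTE.
  have [->|sb] := pselect (s = sphere_pt R n).
    have vL : geom L (vertex_pt v).
      by case: vA => v0 [v1 /setDP[vL _]].
    pose z : SX := exist _ (vertex_pt v) (mem_set vL); exists z.
    have /subcomplexP m0 : geom A (set_val z) by exact: vA.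
    rewrite (@collapseE i) => [|j _]; last exact: m0.
    by have /facet_map_base -> := m0 i.
  have [| |x [x0 x1 xF xs]] := @sphere_map_surj R V n (e i) (set_val s) (@inje i) _ _.
  - by case: s {sb} => s ss; exact: set_mem ss.
  - by move=> sE; apply: sb; apply: val_inj.
  have xL : geom L x by apply/geom_realE; split => //; rewrite xF.
  pose z : SX := exist _ x (mem_set xL); exists z; rewrite (@collapseE i).
    by congr (wl i _); apply: val_inj.
  move=> j ji; apply/eqP; apply: contraNT ji => mj; apply/eqP/injF.
  by rewrite -(vmin_facet mj) -xF.
- move=> x y /subcomplexP mx /subcomplexP my.
  rewrite (@collapseE ord0) => [|j _]; last exact: mx.
  rewrite (@collapseE ord0 y) => [|j _]; last exact: my.
  by have /facet_map_base -> := mx ord0; have /facet_map_base -> := my ord0.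
(* The base point has fibre [A], and the open facets map injectively to the punctured spheres; by
   symmetry one point in an open facet is enough. *)
- have half x y : collapse x = collapse y -> m (active x) x != 0 -> x = y.
    move=> exy mx; have nb : facet_map (active x) x <> sphere_pt R n.
      by move/facet_map_base => mx0; move: mx; rewrite mx0 eqxx.
    have E := @wedge_lift_inj _ (fun=> sphere_space R n) (fun=> sphere_pt R n)
      _ _ _ _ nb exy.
    have axy : active x = active y by move: E => /(congr1 (fun t => projT1 t)).
    move: E => /(congr1 (fun t : {_ : 'I_k.+1 & sphere_space R n} =>
      projT2 t : sphere_space R n)) /=; rewrite -axy => E; apply: val_inj.
    have my : m (active x) y != 0.
      by apply/eqP => /facet_map_base my; apply: nb; rewrite E.
    have [x0 x1 _] := geomP x; have [y0 y1 _] := geomP y.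
    apply: (sphere_map_inj (@inje (active x))) => //; try exact: vmin_facet.
    by move: E => /(congr1 val).
  have act0 x : m (active x) x = 0 -> geom A (set_val x).
    move=> mx; apply/subcomplexP => i; apply/eqP/negPn/negP => mi.
    by move: mx; rewrite (active_eq mi) => /eqP; apply/negP.
  move=> x y exy; have [/act0 mx|mx] := eqVneq (m (active x) x) 0; last first.
    by left; exact: half.
  have [/act0 my|my] := eqVneq (m (active y) y) 0; last first.
    by left; apply/esym; exact: half.
  by right.
Qed.

End WedgeMap.

Local Close Scope ring_scope.
Local Close Scope classical_set_scope.

(** * Complexes encoded as tries of bit vectors *)

Lemma free_face_complex (V : finType) (K : {set {set V}}) (s : {set V}) (v : V) :
  is_simplicial_complex K -> free_face K s v ->
  is_simplicial_complex (K :\: [set s; v |: s]).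
Proof.
move=> [K0 Kd] [sK vs vsK fr]; split; first by rewrite !inE (negbTE K0) andbF.
move=> r t /setDP[rK nr] tr t0; apply/setDP; split; first exact: Kd tr t0.
have st : s \subset t -> s \subset r by move=> /fintype.subset_trans; apply.
have aux : s \subset t -> r \in [set s; v |: s].
  by move=> /st /(fr _ rK) [] ->; rewrite !inE eqxx ?orbT.
apply: contra nr => /set2P[] et; apply: aux; rewrite et //.
exact: subsetU1.
Qed.

Inductive trie := Emp | Leaf | Br of trie & trie.

Fixpoint tmem (t : trie) (b : bitseq) : bool :=
  match t, b with
  | Leaf, [::] => true
  | Br l r, x :: b' => if x then tmem r b' else tmem l b'
  | _, _ => false
  end.

Definition br (l r : trie) :=
  match l, r with Emp, Emp => Emp | _, _ => Br l r end.

Fixpoint trem (t : trie) (b : bitseq) : trie :=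
  match t, b with
  | Br l r, x :: b' => if x then br l (trem r b') else br (trem l b') r
  | _, _ => Emp
  end.

Fixpoint cofaces (t : trie) (b : bitseq) : seq bitseq :=
  match t, b with
  | Br l r, true :: b' => map (cons true) (cofaces r b')
  | Br l r, false :: b' =>
      (if tmem r b' then [:: true :: b'] else [::]) ++ map (cons false) (cofaces l b')
  | _, _ => [::]
  end.

Fixpoint members (t : trie) : seq bitseq :=
  match t with
  | Emp => [::]
  | Leaf => [:: [::]]
  | Br l r => map (cons false) (members l) ++ map (cons true) (members r)
  end.

(** The words that contain none of the masks [cs]. A mask with no remaining bit set is already
    contained in the word. Choosing bit 0 discards the masks that require this bit, choosing bit 1
    keeps all of them. *)
Fixpoint avoid (n : nat) (cs : seq bitseq) : trie :=
  if has (all negb) cs then Emp else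
  if n is n'.+1 then
    br (avoid n' [seq behead c | c <- cs & ~~ head false c])
       (avoid n' (map behead cs))
  else Leaf.

(** The bound [m] restricts the free faces to those with more than [m] vertices; even [m = 0]
    excludes the word of the empty set, which a trie may contain. *)
Definition collapse_step n m (t : trie) (s : bitseq) : trie :=
  if [&& size s == n, m < count id s & tmem t s] then
    if cofaces t s is [:: s'] then trem (trem t s) s' else t
  else t.

Definition collapse_pass n m t := foldl (collapse_step n m) t (members t).

Lemma tmem_br l r b : tmem (br l r) b = tmem (Br l r) b.
Proof. by case: l r => [||? ?] [||? ?] //; case: b => // -[]. Qed.

Lemma tmem_trem t b c : size c = size b -> tmem (trem t b) c = tmem t c && (c != b).
Proof.
elim: t b c => [||l IHl r IHr] [|x b] [|y c] //= [sz].
rewrite eqseq_cons; case: x; rewrite tmem_br /=; case: y; rewrite ?IHl ?IHr //=;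
  by rewrite ?andbT.
Qed.

Lemma members_mem t b : tmem t b -> b \in members t.
Proof.
elim: t b => [||l IHl r IHr] [|x b] //=; rewrite mem_cat.
by case: x => [/IHr|/IHl] bm; rewrite map_f ?orbT.
Qed.

Lemma tmem_avoid n cs b : all (fun c => size c == n) cs -> size b = n ->
  tmem (avoid n cs) b = ~~ has (fun c => all2 implb c b) cs.
Proof.
elim: n cs b => [|n IH] cs b szc; case: b => [|x b] // szb.
  rewrite /=; have -> : has (all negb) cs = has (fun c => all2 implb c [::]) cs.
    by apply: eq_in_has => c /(allP szc)/eqP/size0nil ->.
  by case: has.
have implb0 (c b' : bitseq) : size c = size b' -> all negb c -> all2 implb c b'.
  elim: c b' => [|y c IHc] [|z b'] //= [sz] /andP[/negbTE -> /(IHc b' sz) ->] //.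
rewrite [avoid _ _]/=; case: ifP => [/hasP[c cC c0]|_].
  apply/esym/negbF/hasP; exists c => //; apply: implb0 => //.
  by rewrite szb; apply/eqP/(allP szc).
have szb' : size b = n by case: szb.
have sz1 : all (fun c => size c == n) (map behead cs).
  by apply/allP => _ /mapP[c /(allP szc)/eqP cn ->]; rewrite size_behead cn.
rewrite tmem_br /= {szb}; case: x.
  rewrite IH // has_map; congr negb; apply: eq_in_has => c /(allP szc).
  by case: c => //= -[].
rewrite IH //; last by apply/allP => d /mapP[c]; rewrite mem_filter => /andP[_ cC] ->;
  apply: (allP sz1); exact: map_f.
rewrite has_map has_filter -filter_predI -has_filter; congr negb.
by apply: eq_in_has => c /(allP szc); case: c => //= -[] c _; rewrite ?andbF ?andbT.
Qed.

(** Words are given by an arbitrary predicate [p], so that the induction can shorten [es] without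
    changing the set it describes. *)
Lemma cofacesP (U : eqType) (p : pred U) t es s : uniq es ->
  (s \in cofaces t (map p es)) <->
  exists e, [/\ e \in es, ~~ p e, s = [seq (x == e) || p x | x <- es] & tmem t s].
Proof.
elim: es t s => [|x es IH] t s /=.
  by move=> _; split => [|[e []] //]; case: t.
move=> /andP[xes ues]; case: t => [||l r] /=.
- by split => // -[e [_ _ ->]].
- by split => // -[e [_ _ ->]].
have neq e : e \in es -> (x == e) = false.
  by move=> ees; apply/eqP => xe; move: xes; rewrite xe ees.
have px : ~~ p x -> [seq (y == x) || p y | y <- es] = map p es.
  move=> _; apply/eq_in_map => y /neq; by rewrite eq_sym => ->.
case: (boolP (p x)) => [pxT|pxF].
  split => [/mapP[s' /(IH r s' ues) [e [ees pe s'E ts']] ->]|].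
    by exists e; split => //; [rewrite inE ees orbT|rewrite /= (neq e ees) ?pxT -s'E].
  move=> [e []]; rewrite inE => /predU1P[->|ees pe ->]; first by rewrite ?pxT.
  rewrite ?pxT orbT => tm; apply: map_f; apply/(IH r _ ues).
  by exists e.
rewrite mem_cat; split.
  case/orP => [|/mapP[s' /(IH l s' ues) [e [ees pe s'E ts']] ->]].
    case: ifP => // tr; rewrite inE => /eqP ->; exists x.
    by rewrite mem_head eqxx /= px // (negbTE pxF).
  by exists e; split => //; [rewrite inE ees orbT|rewrite /= (neq e ees) ?(negbTE pxF) -s'E].
move=> [e []]; rewrite inE => /predU1P[->|ees pe ->].
  by move=> _ ->; rewrite eqxx /= px // => ->; rewrite mem_head.
rewrite (neq e ees) ?(negbTE pxF) /= => tl; apply/orP; right; apply: map_f.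
by apply/(IH l _ ues); exists e.
Qed.

(** * Finite sets as bit vectors over a list of vertices *)

Section Codes.
Context {U : finType} (es : seq U).
Hypothesis ues : uniq es.
Implicit Types (W : {set U}) (t : trie).

Definition bits W : bitseq := [seq e \in W | e <- es].
Definition unbits (b : bitseq) : {set U} := [set e in mask b es].

Lemma size_bits W : size (bits W) = size es.
Proof. exact: size_map. Qed.

Lemma unbits_sub b : unbits b \subset es.
Proof. by apply/fintype.subsetP => e; rewrite inE => /mem_mask. Qed.

Lemma unbitsK b : size b = size es -> bits (unbits b) = b.
Proof.
move=> sz; rewrite /bits; under eq_map => e do rewrite inE.
elim: es b ues sz => [|x s IH] [|y b] //= /andP[xs us] [sz].
have nm e : e \in s -> (x == e) = false.
  by move=> es'; apply/eqP => xe; move: xs; rewrite xe es'.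
case: y => /=; rewrite ?mem_head; congr cons.
- rewrite -[RHS](IH b us sz); apply/eq_in_map => e /nm.
  by rewrite inE eq_sym => ->.
- by apply/negP => /mem_mask; apply/negP.
- exact: IH.
Qed.

Lemma bitsK W : W \subset es -> unbits (bits W) = W.
Proof.
move=> /fintype.subsetP Wes; apply/setP => e.
rewrite inE -filter_mask mem_filter; case: (boolP (e \in W)) => //= /Wes //.
Qed.

Lemma bits_inj W W' : W \subset es -> W' \subset es -> bits W = bits W' -> W = W'.
Proof. by move=> Wes W'es eb; rewrite -(bitsK Wes) -(bitsK W'es) eb. Qed.

Lemma count_bits W : W \subset es -> count id (bits W) = #|W|.
Proof.
move=> /fintype.subsetP Wes; rewrite count_map -size_filter cardE.
apply/esym/perm_size/uniq_perm; rewrite ?enum_uniq ?filter_uniq //.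
by move=> e; rewrite mem_enum mem_filter /=; case: (boolP (e \in W)) => //= /Wes ->.
Qed.

Definition trie_complex t : {set {set U}} :=
  [set W : {set U} | [&& W != finset.set0, W \subset es & tmem t (bits W)]].

Lemma trie_complex_trem t b : size b = size es ->
  trie_complex (trem t b) = trie_complex t :\ unbits b.
Proof.
move=> sz; apply/setP => W; rewrite !inE; have [|] := boolP (W \subset es) => Wes /=;
  last by rewrite !andbF.
rewrite tmem_trem ?size_bits // andbA [RHS]andbC; congr (_ && ~~ _).
by apply/eqP/eqP => [<-|->]; rewrite ?bitsK ?unbitsK.
Qed.

Lemma cofaces_bits t W e : W \subset es -> e \in es -> e \notin W ->
  tmem t (bits (e |: W)) -> bits (e |: W) \in cofaces t (bits W).
Proof.
move=> Wes ees eW te; apply/cofacesP => //; exists e; split => //.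
by apply: eq_map => x; rewrite !inE.
Qed.

(** A single coface of codimension 1 already makes the face free: for any face [r] above [W] and any
    [e] in [r] outside [W], the set [e |: W] is such a coface, so [e = v]. *)
Lemma collapse_stepP n m t s : n = size es -> is_simplicial_complex (trie_complex t) ->
  collapse_step n m t s = t \/ exists W v, free_face (trie_complex t) W v /\
    trie_complex (collapse_step n m t s) = trie_complex t :\: [set W; v |: W].
Proof.
move=> -> [K0 Kd]; rewrite /collapse_step.
case: and3P => [[/eqP sz ms ts]|]; last by left.
case cE : cofaces => [|s' [|]]; [by left| |by left]; right.
have [W sW Wes] : exists2 W, s = bits W & W \subset es.
  by exists (unbits s); [rewrite unbitsK|exact: unbits_sub].
have : s' \in cofaces t (bits W) by rewrite -sW cE mem_head.
move=> /(cofacesP _ _ _ ues) [v [ves vW s'E ts']].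
have s'W : s' = bits (v |: W) by rewrite s'E; apply: eq_map => x; rewrite !inE.
have vWes : v |: W \subset es.
  apply/fintype.subsetP => x; rewrite finset.in_setU1 => /predU1P[->|xW].
    exact: ves.
  exact: (fintype.subsetP Wes x xW).
exists W, v; split; last first.
  rewrite s'W sW !trie_complex_trem ?size_bits // !bitsK //.
  by apply/setP => r; rewrite !inE negb_or andbCA andbA.
have W0 : W != finset.set0.
  by rewrite -card_gt0 -count_bits // -sW; exact: leq_ltn_trans ms.
have vW0 : v |: W != finset.set0 by apply/set0Pn; exists v; rewrite setU11.
have vWK : v |: W \in trie_complex t by rewrite inE vW0 vWes -s'W.
split => //; first by rewrite inE W0 Wes -sW.
move=> r rK Wr; have [->|nrW] := eqVneq r W; [by left|right].
have only e : e \in r -> e \notin W -> e = v.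
  move=> er eW; have ees : e \in es.
    by move: rK; rewrite inE => /and3P[_ /fintype.subsetP + _]; apply.
  have : e |: W \in trie_complex t.
    apply: Kd rK _ _; first by rewrite finset.subUset finset.sub1set er.
    by apply/set0Pn; exists e; rewrite setU11.
  rewrite inE => /and3P[_ eWes te]; have := cofaces_bits Wes ees eW te.
  rewrite -sW cE inE s'W => /eqP/(bits_inj eWes vWes)/setP/(_ e).
  by rewrite !inE eqxx (negbTE eW) !orbF => /esym/eqP.
have [e er eW] : exists2 e, e \in r & e \notin W.
  apply/fintype.subsetPn; apply: contra nrW => rW.
  by rewrite finset.eqEsubset rW.
apply/eqP; rewrite finset.eqEsubset finset.subUset Wr.
rewrite finset.sub1set -(only e er eW) er !andbT.
apply/fintype.subsetP => x xr; rewrite !inE; case: (boolP (x \in W)) => [|xW].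
  by rewrite orbT.
by rewrite (only x xr xW) (only e er eW) eqxx.
Qed.

(** Each candidate is tested again in the current trie, so the list of candidates may be arbitrary;
    it is generalized before the induction. *)
Lemma collapse_pass_deforms (R : realType) n m t : n = size es ->
  is_simplicial_complex (trie_complex t) ->
  is_simplicial_complex (trie_complex (collapse_pass n m t)) /\
  deforms (@geom_real R U (trie_complex t))
    (@geom_real R U (trie_complex (collapse_pass n m t))).
Proof.
move=> nes cx; rewrite /collapse_pass; move: (members t) => l.
elim: l t cx => [|s l IH] t cx /=.
  by split => //; exact: deforms_refl.
have [-> |[W [v [fr tE]]]] := collapse_stepP m s nes cx; first exact: IH.
have cx' : is_simplicial_complex (trie_complex (collapse_step n m t s)).
  by rewrite tE; exact: free_face_complex.
have [cxl dl] := IH _ cx'; split => //.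
by apply: deforms_trans dl; rewrite tE; exact: deforms_free_face.
Qed.

Lemma collapse_iter_deforms (R : realType) n m k t : n = size es ->
  is_simplicial_complex (trie_complex t) ->
  is_simplicial_complex (trie_complex (iter k (collapse_pass n m) t)) /\
  deforms (@geom_real R U (trie_complex t))
    (@geom_real R U (trie_complex (iter k (collapse_pass n m) t))).
Proof.
move=> nes cx; elim: k => [|k [IHc IHd]] /=; first by split => //; exact: deforms_refl.
have [cx' d'] := collapse_pass_deforms R m nes IHc; split => //.
exact: deforms_trans d'.
Qed.

Lemma trie_complex_foldl t (l : seq bitseq) : all (fun b => size b == size es) l ->
  trie_complex (foldl trem t l) = trie_complex t :\: [set W in map unbits l].
Proof.
elim: l t => [|b l IH] t /=; first by move=> _; apply/setP => W; rewrite !inE.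
move=> /andP[/eqP sz szl]; rewrite IH // trie_complex_trem //.
apply/setP => W; rewrite !finset.in_setD finset.in_set1 !inE negb_or andbA.
by rewrite [X in X && _]andbC.
Qed.

End Codes.

(** * Checking the two collapses and the critical facets *)

Section Certificate.
Context {U : finType} (es : seq U).
Hypothesis ues : uniq es.
Implicit Types (t : trie) (crit : seq bitseq).

Definition facets_ok N n t crit := uniq crit && all (fun c =>
  [&& size c == N, count id c == n, tmem t c & nilp (cofaces t c)]) crit.

Definition point_ok N t :=
  if [seq b <- members t | has id b] is [:: b]
  then [&& size b == N, count id b == 1 & tmem t b] else false.

(** With bound [n], the first passes remove only faces of dimension at least [n], which leaves the
    boundaries of the [n]-simplices intact. The bound 0 of the later passes admits all nonempty
    faces. *)
Definition wedge_ok N n i j t crit :=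
  let tL := iter i (collapse_pass N n) t in
  facets_ok N n.+1 tL crit &&
  point_ok N (iter j (collapse_pass N 0) (foldl trem tL crit)).

Lemma point_okP N t : N = size es -> point_ok N t ->
  exists v, trie_complex es t = [set [set v]].
Proof.
move=> ->; rewrite /point_ok; case mE : [seq _ <- _ | _] => [|b [|]] //.
move=> /and3P[/eqP sz /eqP b1 tb]; have bsub := unbits_sub es b.
have /cards1P[v bv] : #|unbits es b| == 1.
  by rewrite -(count_bits ues bsub) unbitsK // b1.
exists v; rewrite -bv; apply/setP => W; rewrite finset.in_set1; apply/idP/eqP => [|->].
  rewrite inE => /and3P[W0 Wes tW].
  have : bits es W \in [seq b <- members t | has id b].
    by rewrite mem_filter members_mem // andbT has_count count_bits // card_gt0.
  by rewrite mE inE => /eqP <-; rewrite bitsK.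
rewrite !inE unbitsK // tb bsub bv; apply/andP; split => //.
by apply/set0Pn; exists v; rewrite inE.
Qed.

Lemma cofaces_nil_max t (W r : {set U}) : is_simplicial_complex (trie_complex es t) ->
  W \subset es -> nilp (cofaces t (bits es W)) -> r \in trie_complex es t ->
  W \subset r -> r = W.
Proof.
move=> [_ Kd] Wes /nilP cE rK Wr; apply/eqP; rewrite finset.eqEsubset Wr andbT.
apply: contraT => /fintype.subsetPn[e er eW].
have ees : e \in es.
  by move: rK; rewrite inE => /and3P[_ /fintype.subsetP + _]; apply.
have : e |: W \in trie_complex es t.
  apply: Kd rK _ _; first by rewrite finset.subUset finset.sub1set er.
  by apply/set0Pn; exists e; rewrite setU11.
rewrite inE => /and3P[_ _ te].
by have := cofaces_bits ues Wes ees eW te; rewrite cE.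
Qed.

Lemma trie_wedge (R : realType) N n k i j t crit : N = size es ->
  is_simplicial_complex (trie_complex es t) -> size crit = k.+1 ->
  wedge_ok N n i j t crit ->
  homotopy_equivalent R (realization R (trie_complex es t)) (wedge_spheres R k.+1 n).
Proof.
move=> NE cx sk /andP[]; set tL := iter i _ t => /andP[ucrit /allP hcrit] pt.
have [cxL dL] := collapse_iter_deforms ues R n i NE cx.
rewrite -/tL in cxL dL.
have hc c : c \in crit -> [/\ size c = size es, count id c = n.+1, tmem tL c &
    nilp (cofaces tL c)].
  by rewrite -NE => /hcrit/and4P[/eqP ? /eqP ? ? ?].
pose F (a : 'I_k.+1) := nth [::] crit a.
have Fc a : F a \in crit by rewrite mem_nth // sk.
have Finj : injective F.
  by move=> a b /eqP; rewrite nth_uniq ?sk // => /eqP/val_inj.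
have [v0 _] : exists v0 : U, v0 \in es.
  have [sz cnt _ _] := hc _ (Fc ord0).
  by case: es sz => [/size0nil e0|v0 l _]; [rewrite e0 in cnt|exists v0; rewrite mem_head].
pose e (a : 'I_k.+1) (b : 'I_n.+1) : U := nth v0 (mask (F a) es) b.
have szm a : size (mask (F a) es) = n.+1.
  by have [sz cnt _ _] := hc _ (Fc a); rewrite size_mask.
have inje a : injective (e a).
  by move=> b c /eqP; rewrite nth_uniq ?szm // ?mask_uniq // => /eqP/val_inj.
have faceE a : face (e a) = unbits es (F a).
  apply/setP => u; rewrite inE; apply/imsetP/idP => [[b _ ->]|um].
    by rewrite mem_nth // szm.
  have iu : (index u (mask (F a) es) < n.+1)%N by rewrite -(szm a) index_mem.
  by exists (Ordinal iu) => //; rewrite /e /= nth_index.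
have bF a : bits es (unbits es (F a)) = F a.
  by have [sz _ _ _] := hc _ (Fc a); rewrite unbitsK.
have injF : injective (fun a => face (e a)).
  by move=> a b; rewrite !faceE => /(congr1 (bits es)); rewrite !bF => /Finj.
have FL a : face (e a) \in trie_complex es tL.
  have [_ _ tF _] := hc _ (Fc a); rewrite inE face_neq0 faceE unbits_sub bF.
  exact: tF.
have Fmax a s : s \in trie_complex es tL -> face (e a) \subset s -> s = face (e a).
  rewrite faceE => sL; apply: cofaces_nil_max cxL _ _ sL; first exact: unbits_sub.
  by rewrite bF; have [] := hc _ (Fc a).
have AE : trie_complex es (foldl trem tL crit) =
    trie_complex es tL :\: [set face (e a) | a : 'I_k.+1].
  rewrite trie_complex_foldl //; last by apply/allP => c /hc[/eqP].
  congr (_ :\: _); apply/setP => W; rewrite inE; apply/mapP/imsetP.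
    move=> [c cc ->]; have ic : (index c crit < k.+1)%N by rewrite -sk index_mem.
    by exists (Ordinal ic) => //; rewrite faceE /F /= nth_index.
  by move=> [a _ ->]; exists (F a); rewrite ?faceE.
have cxA := facet_complement_complex cxL Fmax; rewrite -AE in cxA.
have [_ dA] := collapse_iter_deforms ues R 0 j NE cxA.
have [v tE] := point_okP NE pt; rewrite tE AE in dA.
exact: (homotopy_equivalent_wedge cxL inje injF FL Fmax dL dA).
Qed.

End Certificate.

(** * The Morse complex of a simplex *)

Lemma all2_mem_map (U : eqType) (c es : seq U) (p : pred U) : {subset c <= es} ->
  all2 implb [seq e \in c | e <- es] [seq p e | e <- es] = all p c.
Proof.
move=> ces; have -> : all2 implb [seq e \in c | e <- es] [seq p e | e <- es] =
    all (fun e => (e \in c) ==> p e) es.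
  by elim: es {ces} => //= e es ->.
apply/allP/allP => [h e ec|h e _]; first by have := h e (ces e ec); rewrite ec.
by apply/implyP; exact: h.
Qed.

Fixpoint words n : seq bitseq :=
  if n is n'.+1 then map (cons false) (words n') ++ map (cons true) (words n')
  else [:: [::]].

Lemma mem_words n b : (b \in words n) = (size b == n).
Proof.
have inj x : injective (cons x : bitseq -> bitseq) by move=> ? ? [].
elim: n b => [|n IH] [|x b] //=; rewrite mem_cat.
  by apply/negP => /orP[] /mapP[].
have nm y c s : (y :: c \in map (cons (~~ y)) s) = false.
  by apply/negP => /mapP[? _ []]; case: y.
by case: x; rewrite ?(nm true) ?(nm false) ?orbF ?orFb mem_map.
Qed.

Definition code := (bitseq * bitseq)%type.

Definition covers (a b : bitseq) := all2 implb a b && (count id b == (count id a).+1).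

(** The order of this list matters: it fixes the order in which the greedy collapse tries the faces,
    hence which facets are critical. *)
Definition codes n : seq code :=
  let nodes := [seq b <- words n | has id b] in
  rev [seq (a, b) | a <- nodes, b <- [seq b <- nodes | covers a b]].

Lemma mem_codes n (e : code) : (e \in codes n) =
  [&& size e.1 == n, has id e.1, size e.2 == n, has id e.2 & covers e.1 e.2].
Proof.
rewrite /codes mem_rev; apply/allpairsPdep/idP => [[a [b []]]|].
  rewrite !mem_filter !mem_words => /andP[ha sa] /and3P[cab hb sb] ->.
  by rewrite /= sa ha sb hb cab.
case: e => a b /= /and5P[sa ha sb hb cab]; exists a, b.
by rewrite !mem_filter !mem_words ha sa cab hb sb.
Qed.

Definition share (e f : code) := [|| e.1 == f.1, e.1 == f.2, e.2 == f.1 | e.2 == f.2].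

(* e and f are consecutive matched edges of an alternating path. *)
Definition follows (e f : code) := (e.2 != f.2) && covers e.1 f.2.

Fixpoint walks (es : seq code) k (e : code) : seq (seq code) :=
  if k is k'.+1 then
    flatten [seq map (cons f) (walks es k' f) | f <- es & follows e f]
  else [:: [::]].

Definition nonfaces n : seq (seq code) :=
  let es := codes n in
  [seq [:: e; f] | e <- es, f <- [seq f <- es | (e != f) && share e f]] ++
  [seq c <- flatten [seq map (cons e) (walks es 2 e ++ walks es 3 e) | e <- es]
     | cycle follows c && all (mem es) c].

Definition nonface_masks n : seq bitseq :=
  undup [seq [seq e \in c | e <- codes n] | c <- nonfaces n].

Definition prune (W : seq code) := [seq e <- W | has (follows e) W].

Definition morse_trie n := avoid (size (codes n)) (nonface_masks n).

(** Pruning deletes the edges without a follower, hence at least one per round from a nonempty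
    acyclic matching. For [n = 4] such a matching pairs off at most 14 of the 15 simplices, so it
    has at most 7 edges and the 8 rounds suffice. *)
Definition morse_ok n :=
  let es := codes n in
  all (fun b => nilp (iter n.*2 prune (mask b es))) (members (morse_trie n)).

(** * Directed cycles, alternating walks and the faces of the Morse complex *)

Section Encoding.
Variable n : nat.
Local Notation T := 'I_n.
Local Notation V := ({set T} * {set T})%type.
Local Notation H := (hasse_edge (full_simplex T)).
Implicit Types (e f : V) (W : {set V}).

Let uT : uniq (enum T) := enum_uniq T.

Definition encode e : code := (bits (enum T) e.1, bits (enum T) e.2).
Definition decode (c : code) : V := (unbits (enum T) c.1, unbits (enum T) c.2).

Lemma sub_enum (s : {set T}) : s \subset enum T.
Proof. by apply/fintype.subsetP => x _; rewrite mem_enum. Qed.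

Lemma encodeK : cancel encode decode.
Proof. by case=> a b; rewrite /decode /encode /= !bitsK ?sub_enum. Qed.

Lemma decodeK : {in codes n, cancel decode encode}.
Proof.
move=> c; rewrite mem_codes => /and5P[/eqP s1 _ /eqP s2 _ _].
by rewrite /encode /decode /= !unbitsK ?size_enum_ord //; case: c {s1 s2}.
Qed.

Lemma bits_subset (s t : {set T}) :
  all2 implb (bits (enum T) s) (bits (enum T) t) = (s \subset t).
Proof.
have -> : all2 implb (bits (enum T) s) (bits (enum T) t) =
    all (fun x => (x \in s) ==> (x \in t)) (enum T).
  by rewrite /bits; elim: (enum T) => //= x l ->.
apply/allP/fintype.subsetP => h x.
  by have := h x (mem_enum _ _); move=> + xs; rewrite xs.
by move=> _; apply/implyP; exact: h.
Qed.

Lemma hasse_encode e : H e = (encode e \in codes n).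
Proof.
have h0 (s : {set T}) : has id (bits (enum T) s) = (s != finset.set0).
  by rewrite has_count count_bits ?sub_enum // card_gt0.
rewrite mem_codes /hasse_edge /encode /= !size_bits !size_enum_ord eqxx !h0 /covers.
rewrite bits_subset !count_bits ?sub_enum // !inE /=.
have [e21|] := eqVneq #|e.2| #|e.1|.+1; last by rewrite !andbF.
rewrite !andbT; congr [&& _, _ & _]; rewrite finset.properEcard e21 ltnSn.
by rewrite andbT.
Qed.

Definition edges : seq V := map decode (codes n).

Lemma mem_edges e : (e \in edges) = H e.
Proof.
rewrite hasse_encode; apply/mapP/idP => [[c cc ->]|ee]; first by rewrite decodeK.
by exists (encode e) => //; rewrite encodeK.
Qed.

Lemma size_edges : size edges = size (codes n).
Proof. exact: size_map. Qed.

Lemma uniq_edges : uniq (codes n) -> uniq edges.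
Proof. by move=> uc; rewrite map_inj_in_uniq //; exact: (can_in_inj decodeK). Qed.

Lemma tmem_morse W : tmem (morse_trie n) (bits edges W) <->
  forall c, c \in nonfaces n -> exists2 u, u \in c & decode u \notin W.
Proof.
have cs c : c \in nonfaces n -> {subset c <= codes n}.
  rewrite mem_cat => /orP[/allpairsPdep[u [w []]]|].
    by rewrite mem_filter => uc /andP[_ wc] -> x; rewrite !inE => /orP[]/eqP ->.
  by rewrite mem_filter => /andP[/andP[_ /allP]].
have -> : bits edges W = [seq decode u \in W | u <- codes n].
  by rewrite /bits /edges -map_comp.
rewrite tmem_avoid ?size_map //; last first.
  by apply/allP => b; rewrite mem_undup => /mapP[c _ ->]; rewrite size_map.
split=> [/hasPn h c cn|h].
  have := h [seq u \in c | u <- codes n]; rewrite mem_undup.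
  rewrite (map_f (fun c : seq code => [seq u \in c | u <- codes n]) cn) => /(_ isT).
  rewrite all2_mem_map; last exact: cs.
  by move=> /allPn[u uc uW]; exists u.
apply/hasPn => b; rewrite mem_undup => /mapP[c cn ->].
rewrite all2_mem_map; last exact: cs.
by have [u uc uW] := h c cn; apply/allPn; exists u.
Qed.

Lemma matchingP W : is_matching (full_simplex T) W <->
  (forall e, e \in W -> H e) /\
  (forall e f, e \in W -> f \in W -> e != f ->
     [&& e.1 != f.1, e.1 != f.2, e.2 != f.1 & e.2 != f.2]).
Proof.
rewrite /is_matching; split => [/andP[/forallP h1 /forallP h2]|[h1 h2]].
  split=> [e eW|e f eW fW ef]; first by have := h1 e; rewrite eW.
  by have /implyP/(_ eW)/forallP/(_ f)/implyP/(_ fW)/implyP/(_ ef) := h2 e.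
apply/andP; split; apply/forallP => e; apply/implyP => eW; first exact: h1.
apply/forallP => f; apply/implyP => fW; apply/implyP => ef; exact: h2.
Qed.

Fixpoint alternate e (c : seq V) : seq {set T} :=
  if c is f :: c' then e.1 :: f.2 :: alternate f c' else [::].

Lemma last_alternate e c : last e.2 (alternate e c) = (last e c).2.
Proof. by elim: c e => //= f c IH e; exact: IH. Qed.

(** The step down reverses the matched edge [e]. The step up from [e.1] to [f.2] is unmatched: a
    matched one would meet [e] in [e.1], hence equal [e], and [follows] rules out [e.2 = f.2]. *)
Lemma path_alternate W e c : is_matching (full_simplex T) W ->
  {subset e :: c <= W} -> path follows (encode e) (map encode c) ->
  path (modified_arc (full_simplex T) W) e.2 (alternate e c).
Proof.
move=> /matchingP[hW mW]; elim: c e => //= f c IH e ecW /andP[/andP[ef cov] pf].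
have eW : e \in W by apply: ecW; rewrite inE eqxx.
have fW : f \in W by apply: ecW; rewrite !inE eqxx orbT.
rewrite IH //; last by move=> x xc; apply: ecW; rewrite inE xc orbT.
rewrite andbT; apply/andP; split.
  by rewrite /modified_arc -surjective_pairing eW orbT.
apply/orP; left; apply/andP; split.
  have := hW e eW; have := hW f fW; rewrite !hasse_encode !mem_codes /=.
  by move=> /and5P[_ _ -> -> _] /and5P[-> -> _ _ _].
apply/negP => e12W; have := mW _ _ eW e12W.
rewrite /= eqxx /=; case: eqP => [E|_ /(_ isT)//] _.
by move: ef; rewrite {1}E /= eqxx.
Qed.

Lemma cycle_not_acyclic W c : is_matching (full_simplex T) W ->
  c != [::] -> {subset c <= codes n} -> (forall x, x \in c -> decode x \in W) ->
  cycle follows c -> ~ is_acyclic (full_simplex T) W.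
Proof.
move=> mW; case: c => // x c _ cc cW cyc; apply.
pose y := decode x; pose d := rcons (map decode c) y.
have dK z : z \in x :: c -> encode (decode z) = z by move=> /cc/decodeK.
exists y.2, (alternate y d); apply/and3P; split.
- by rewrite /d; case: (map decode c).
- apply: path_alternate => //.
    move=> z; rewrite inE mem_rcons inE => /or3P[/eqP->|/eqP->|/mapP[u uc ->]];
      apply: cW; by rewrite inE ?eqxx ?uc ?orbT.
  rewrite /d map_rcons -map_comp (dK x) ?mem_head //.
  rewrite (_ : map _ c = c) //; rewrite -[RHS]map_id; apply/eq_in_map => u uc.
  by rewrite /= dK // inE uc orbT.
- by rewrite last_alternate /d last_rcons.
Qed.

Lemma iter_prune k (S l : seq code) :
  (forall u, u \in S -> has (follows u) S) -> {subset S <= l} ->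
  {subset S <= iter k prune l}.
Proof.
move=> hS Sl; elim: k => //= k IH u uS; rewrite mem_filter IH // andbT.
by have /hasP[w wS uw] := hS u uS; apply/hasP; exists w => //; exact: IH.
Qed.

(* On a directed cycle, a node of maximal size is left along a matched edge and
   the next step goes up again, so the matched edges at the top level of the
   cycle form a set in which each one is followed by another. *)
Lemma prune_acyclic W : is_matching (full_simplex T) W ->
  nilp (iter n.*2 prune [seq c <- codes n | decode c \in W]) ->
  is_acyclic (full_simplex T) W.
Proof.
move=> /matchingP[hW mW] /nilP pr [x [p /and3P[p0 xp /eqP lp]]].
set r := modified_arc _ W in xp.
case: (lastP p) p0 lp xp => // q y _; rewrite last_rcons => ->.
rewrite -[path _ _ _]/(cycle r (x :: q)) => cyc; set c := x :: q in cyc.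
have arc z : z \in c -> r z (next c z) by exact: next_cycle cyc.
have nc z : (next c z \in c) = (z \in c) by exact: mem_next.
have [z0 z0c zmax] : exists2 z, z \in c & forall y, y \in c -> #|y| <= #|z|.
  case: (@arg_maxnP _ x (mem c) (fun z => #|z|) (mem_head _ _)) => z zc zmax.
  by exists z.
set m := #|z0| in zmax.
have down z : z \in c -> #|z| = m -> (next c z, z) \in W.
  move=> zc zm; have /orP[/andP[/and4P[_ _ _ /eqP sz] _]|//] := arc z zc.
  by have := zmax (next c z); rewrite nc zc sz /= zm ltnn => /(_ isT).
pose S := [seq u <- codes n |
  [&& decode u \in W, (decode u).2 \in c & #|(decode u).2| == m]].
have inS z : z \in c -> #|z| = m -> encode (next c z, z) \in S.
  move=> zc zm; have W1 := down z zc zm; rewrite mem_filter encodeK W1 /= zc zm eqxx /=.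
  by rewrite -hasse_encode hW.
have S_follows u : u \in S -> has (follows u) S.
  rewrite mem_filter => /andP[/and3P[uW zc /eqP zm] uc].
  set z := (decode u).2 in zc zm; have W1 := down z zc zm.
  have uE : decode u = (next c z, z).
    apply/eqP; apply: contraT => ne; have := mW _ _ uW W1 ne.
    by rewrite /= eqxx !andbF.
  have z1c : next c z \in c by rewrite nc.
  have z1m : #|next c z|.+1 = m.
    by have /and4P[_ _ _ /eqP] := hW _ W1; rewrite /= zm => ->.
  have /orP[/andP[up nW]|W2] := arc _ z1c; last first.
    have := mW _ _ W2 W1; rewrite /= eqxx /= !andbF; case: eqP => [[_ e1]|_ /(_ isT)//] _.
    by move: z1m; rewrite (e1 : next c z = z) zm => /eqP; rewrite eqn_leq ltnn.
  have z2c : next c (next c z) \in c by rewrite nc.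
  have z2m : #|next c (next c z)| = m.
    by have /and4P[_ _ _ /eqP ->] := up.
  (* After a matched step down and an unmatched step up, [next c (next c z)] is again of maximal
     size, so the cycle leaves it along a matched edge. It differs from [z] since the edge going up
     is not in [W]. *)
  apply/hasP; exists (encode (next c (next c (next c z)), next c (next c z))).
    exact: inS.
  rewrite -(decodeK uc) uE /follows /=; apply/andP; split.
    apply: contra nW => /eqP/(bits_inj (sub_enum _) (sub_enum _)) E.
    by rewrite -(E : z = next c (next c z)).
  by move: up; rewrite hasse_encode mem_codes => /and5P[].
have Sl : {subset S <= [seq u <- codes n | decode u \in W]}.
  by move=> u; rewrite !mem_filter => /andP[/and3P[-> _ _] ->].
by have := iter_prune n.*2 S_follows Sl (inS _ z0c erefl); rewrite pr in_nil.
Qed.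

Lemma pair_nonface W e f : is_matching (full_simplex T) W -> e \in W -> f \in W ->
  e != f -> ~~ share (encode e) (encode f).
Proof.
move=> /matchingP[_ mW] eW fW ef; have /and4P[h1 h2 h3 h4] := mW e f eW fW ef.
have inj (s t : {set T}) : s != t -> bits (enum T) s != bits (enum T) t.
  by apply: contra => /eqP/(bits_inj (sub_enum _) (sub_enum _)) ->.
by rewrite /share /= !negb_or !inj.
Qed.

(** An acyclic matching contains no incident pair and no closed walk, hence no listed nonface.
    Conversely, avoiding the incident pairs gives a matching, and [morse_ok] supplies acyclicity. *)
Lemma mem_trie_morse W : uniq (codes n) -> morse_ok n ->
  (W \in morse_complex (full_simplex T)) = (W \in trie_complex edges (morse_trie n)).
Proof.
move=> uc /allP ok; rewrite !inE; case: (W != finset.set0) => //=.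
apply/andP/andP => [[mW /asboolP aW]|[/fintype.subsetP Wes tW]].
  have [hW _] := (matchingP W).1 mW.
  split; first by apply/fintype.subsetP => e /hW; rewrite -mem_edges.
  apply/tmem_morse => c; rewrite mem_cat => /orP[/allpairsPdep[u [w []]]|].
    rewrite mem_filter => uc' /andP[/andP[uw sh] wc] ->.
    have [uW|uW] := boolP (decode u \in W); last by exists u; rewrite // mem_head.
    have [wW|wW] := boolP (decode w \in W); last by exists w; rewrite // !inE eqxx orbT.
    have := pair_nonface mW uW wW; rewrite !decodeK // sh (can_in_eq decodeK) //.
    by move=> /(_ uw).
  rewrite mem_filter => /andP[/andP[cyc /allP cc] cw].
  apply/exists2P/not_existsP => cW; apply: (@cycle_not_acyclic W c) => //.
  - by case: c cyc cc cw {cW} => //; rewrite /= => _ _ /flattenP[_ /mapP[u _ ->] /mapP[]].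
  - by move=> u uc'; apply/negPn/negP => uW; apply: (cW u).
have nf := (tmem_morse W).1 tW.
have mW : is_matching (full_simplex T) W.
  apply/matchingP; split => [e /Wes|e f eW fW ef]; first by rewrite mem_edges.
  have eH : encode e \in codes n by rewrite -hasse_encode -mem_edges; exact: Wes.
  have fH : encode f \in codes n by rewrite -hasse_encode -mem_edges; exact: Wes.
  apply: contraT => sh; have [|u] := nf [:: encode e; encode f].
    rewrite mem_cat; apply/orP; left; apply/allpairsPdep; exists (encode e), (encode f).
    split => //; rewrite mem_filter fH andbT (inj_eq (can_inj encodeK)) ef /=.
    move: sh; rewrite !negb_and !negbK /share /= => /or4P[]/eqP ->; by rewrite eqxx ?orbT.
  by rewrite !inE => /orP[]/eqP ->; rewrite encodeK ?eW ?fW.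
split => //; apply/asboolP; apply: prune_acyclic => //.
have := ok _ (members_mem tW).
by rewrite filter_mask /bits /edges -map_comp.
Qed.



End Encoding.

Lemma trie_complex_morse n :
  is_simplicial_complex (trie_complex (edges n) (morse_trie n)).
Proof.
split=> [|s t]; first by rewrite inE eqxx.
rewrite !inE => /and3P[_ se ts] ts' ->.
rewrite (fintype.subset_trans ts' se) /=; apply/tmem_morse => c /((tmem_morse s).1 ts).
by move=> [u uc us]; exists u => //; apply: contra us; exact: (fintype.subsetP ts').
Qed.

(* The 4-simplices left unmatched by a greedy lexicographic collapse, each given
   by the positions of its vertices in codes 4. *)
Definition critical_facets : seq (seq nat) :=
  [::[:: 15; 17; 21; 23; 25]; [:: 14; 15; 17; 24; 25]; [:: 13; 17; 21; 22; 26];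
    [:: 13; 16; 17; 22; 27]; [:: 13; 15; 17; 24; 25]; [:: 13; 15; 17; 22; 27];
    [:: 12; 19; 20; 23; 25]; [:: 12; 18; 20; 22; 26]; [:: 12; 15; 20; 23; 25];
    [:: 12; 15; 20; 22; 25]; [:: 12; 15; 18; 24; 25]; [:: 12; 15; 18; 20; 25];
    [:: 12; 15; 17; 23; 27]; [:: 12; 15; 17; 20; 25]; [:: 12; 13; 20; 22; 26];
    [:: 12; 13; 20; 22; 25]; [:: 12; 13; 19; 22; 27]; [:: 12; 13; 19; 20; 22];
    [:: 12; 13; 17; 24; 26]; [:: 12; 13; 17; 20; 22]; [:: 12; 13; 15; 17; 25];
    [:: 11; 12; 17; 20; 22]; [:: 11; 12; 15; 17; 22]; [:: 10; 15; 17; 20; 25];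
    [:: 10; 12; 15; 17; 25]; [:: 9; 15; 21; 23; 25]; [:: 9; 15; 20; 22; 25];
    [:: 9; 15; 18; 21; 25]; [:: 9; 13; 21; 22; 26]; [:: 9; 13; 19; 21; 22];
    [:: 8; 12; 18; 22; 26]; [:: 8; 12; 15; 23; 27]; [:: 8; 12; 15; 17; 24];
    [:: 8; 12; 13; 17; 27]; [:: 8; 10; 12; 23; 26]; [:: 8; 10; 12; 19; 23];
    [:: 8; 10; 12; 18; 26]; [:: 8; 9; 14; 22; 26]; [:: 8; 9; 14; 19; 22];
    [:: 8; 9; 13; 24; 26]; [:: 8; 9; 13; 19; 27]; [:: 8; 9; 12; 19; 27];
    [:: 7; 17; 20; 22; 26]; [:: 7; 16; 17; 23; 27]; [:: 7; 14; 17; 24; 26];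
    [:: 7; 13; 17; 22; 26]; [:: 7; 12; 18; 20; 26]; [:: 7; 12; 17; 23; 27];
    [:: 7; 10; 13; 19; 27]; [:: 7; 10; 12; 24; 26]; [:: 7; 10; 12; 19; 27];
    [:: 7; 10; 12; 19; 24]; [:: 7; 10; 12; 13; 26]; [:: 7; 9; 19; 21; 23];
    [:: 7; 9; 18; 21; 26]; [:: 7; 9; 16; 23; 27]; [:: 7; 9; 16; 18; 27];
    [:: 7; 9; 16; 18; 24]; [:: 7; 9; 14; 24; 26]; [:: 7; 9; 14; 19; 27];
    [:: 7; 9; 14; 19; 24]; [:: 7; 9; 12; 23; 27]; [:: 7; 9; 12; 18; 27];
    [:: 6; 15; 17; 24; 25]; [:: 6; 12; 19; 23; 25]; [:: 6; 12; 17; 24; 26];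
    [:: 6; 12; 13; 24; 26]; [:: 6; 11; 16; 17; 23]; [:: 6; 11; 12; 18; 26];
    [:: 6; 7; 13; 19; 27]; [:: 5; 17; 20; 23; 25]; [:: 5; 12; 15; 23; 27];
    [:: 5; 12; 15; 18; 27]; [:: 5; 12; 15; 18; 24]; [:: 5; 11; 16; 17; 27];
    [:: 5; 11; 16; 17; 24]; [:: 5; 7; 12; 20; 23]; [:: 4; 16; 18; 22; 25];
    [:: 4; 13; 16; 24; 25]; [:: 4; 11; 16; 18; 22]; [:: 4; 11; 16; 17; 27];
    [:: 4; 10; 16; 17; 27]; [:: 4; 10; 14; 19; 25]; [:: 4; 7; 18; 21; 26];
    [:: 4; 7; 9; 19; 23]; [:: 4; 7; 9; 16; 27]; [:: 3; 12; 19; 22; 27];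
    [:: 3; 12; 19; 20; 25]; [:: 3; 12; 19; 20; 23]; [:: 3; 12; 18; 20; 26];
    [:: 3; 11; 19; 21; 22]; [:: 3; 11; 18; 21; 22]; [:: 3; 11; 12; 23; 27];
    [:: 3; 11; 12; 23; 26]; [:: 3; 11; 12; 18; 27]; [:: 3; 11; 12; 18; 26];
    [:: 3; 10; 21; 23; 25]; [:: 3; 4; 11; 16; 27]; [:: 1; 11; 14; 17; 27]].

Definition critical_masks : seq bitseq :=
  [seq mkseq (fun i => i \in c) 28 | c <- critical_facets].

(** The Hasse diagram has [12 + 12 + 4 = 28] edges, counted by the dimension of the smaller simplex.
    The parameters 4, 3 and 20 are the dimension of the spheres and the numbers of passes of the two
    collapses. *)
Lemma collapse_certificate :
  [&& uniq (codes 4), size (codes 4) == 28, size critical_masks == 99, morse_ok 4 &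
    wedge_ok 28 4 3 20 (morse_trie 4) critical_masks].
Proof. by vm_cast_no_check (erefl true). Qed.

(* |M(Delta^3)| is homotopy equivalent to the wedge of 99 copies of S^4. *)
Theorem mainTheorem10 (R : realType) :
  homotopy_equivalent R
    (realization R (morse_complex (full_simplex 'I_4)))
    (wedge_spheres R 99 4).
Proof.
have /and5P[uc /eqP sc /eqP sm mok wok] := collapse_certificate.
have -> : morse_complex (full_simplex 'I_4) = trie_complex (edges 4) (morse_trie 4).
  by apply/setP => W; exact: (mem_trie_morse W uc mok).
have se : 28 = size (edges 4) by rewrite size_edges sc.
exact: (trie_wedge (uniq_edges uc) R se (trie_complex_morse 4) sm wok).
Qed.
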